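(* Fix $d\in\mathbb{N}$. A sequence $\{G_i\}_{i=1}^\infty$ of graphings with maximal degree at most $d$ is local-global convergent if and only if it is convergent in the metric $d_M$ (i.e. the associated $P$-operators form an action convergent sequence).
   Context: A graphing (with degree bound $d$) is a Polish space $X$ with a Borel probability measure $\nu$ and a graph $G$ on vertex set $X$ with Borel edge set $E\subseteq X\times X$, all degrees at most $d$, such that $\int_A e(x,B)\,d\nu(x)=\int_B e(x,A)\,d\nu(x)$ for all measurable $A,B\subseteq X$, where $e(x,S)$ is the number of edges from $x$ to $S$. Finite graphs (with the uniform measure on the vertex set) are graphings. A graphing acts as a $P$-operator on $L^\infty(X,\nu)$ by $(vG)(x)=\sum_{(y,x)\in E}v(y)$. A $k$-coloring is a measurable $f:X\to[k]$. Let $\mathcal{G}_{d,k,r}$ be the finite set of isomorphism classes of $k$-colored rooted graphs of maximal degree at most $d$ and radius at most $r$; $\tau_r(G,f)$ is the distribution on $\mathcal{G}_{d,k,r}$ of the colored radius-$r$ neighborhood of a $\nu$-random root, and $Z_{k,r}(G)$ is the set of all $\tau_r(G,f)$ over $k$-colorings $f$. $\{G_i\}$ is local-global convergent if for all $k,r\ge1$ the sets $Z_{k,r}(G_i)$ converge in the Hausdorff distance induced by total variation distance. For a $P$-operator $A$ on a probability space $\Omega$ (linear $A:L^\infty(\Omega)\to L^1(\Omega)$ with $\sup_v\|vA\|_1/\|v\|_\infty<\infty$), $\mathcal{S}_k(A)$ is the set of joint distributions of $(v_1,\dots,v_k,v_1A,\dots,v_kA)$ over measurable $v_i:\Omega\to[-1,1]$;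 $d_M(A,B):=\sum_k2^{-k}d_H(\mathcal{S}_k(A),\mathcal{S}_k(B))$, where $d_H$ is the Hausdorff distance induced by the Lévy–Prokhorov metric. A sequence is convergent in $d_M$ if for each $k$ the profiles $\mathcal{S}_k$ form a $d_H$-Cauchy sequence. *)

(* Defs.v *)
From HB Require Import structures.
From mathcomp Require Import all_boot all_order all_algebra.
From mathcomp Require Import all_classical all_reals all_analysis.
Set Implicit Arguments. Unset Strict Implicit. Unset Printing Implicit Defensive.
Import Order.TTheory GRing.Theory Num.Theory.
Local Open Scope classical_set_scope.
Local Open Scope ring_scope.

Definition borel (R : realType) (T : completePseudoMetricType R) :=
  g_sigma_algebraType (@open T).

Definition edge_count (R : realType) (T : choiceType) (E : set (T * T))
  (x : T) (S : set T) : R := (\sum_(y \in [set y | E (x, y) /\ S y]) (1 : R))%R.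

Definition Pop (R : realType) (T : choiceType) (E : set (T * T))
  (v : T -> R) (x : T) : R := (\sum_(y \in [set y | E (y, x)]) v y)%R.

Record graphing (R : realType) (D : nat) := Graphing {
  gX : completePseudoMetricType R;
  g_hausdorff : hausdorff_space gX;
  g_separable : exists S : set gX, countable S /\ dense S;
  gnu : probability (borel gX) R;
  gE : set (gX * gX);
  gE_borel : measurable (gE : set (borel gX * borel gX));
  gE_sym : forall x y, gE (x, y) -> gE (y, x);
  gE_irrefl : forall x, ~ gE (x, x);
  gE_deg : forall x, exists s : seq gX,
      (size s <= D)%N /\ forall y, gE (x, y) <-> y \in s;
  g_invariant : forall A B : set (borel gX), measurable A -> measurable B ->
    (\int[gnu]_(x in A) (@edge_count R gX gE x B)%:E
       = \int[gnu]_(x in B) (@edge_count R gX gE x A)%:E)%E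
}.

Arguments gX {R D}.
Arguments gnu {R D}.
Arguments gE {R D}.

Section LocalGlobal.
Variables (R : realType) (D : nat).
Implicit Types G : graphing R D.

Definition coloring G (k : nat) (f : gX G -> 'I_k) :=
  forall i : 'I_k, measurable (f @^-1` [set i] : set (borel (gX G))).

Fixpoint within (T : Type) (E : set (T * T)) (n : nat) (x y : T) : Prop :=
  x = y \/ match n with
           | 0 => False
           | n'.+1 => exists z, E (x, z) /\ within E n' z y
           end.

(** finite k-colored rooted graphs (representatives of isomorphism classes) *)
Record rcgraph (k : nat) := RCGraph {
  rc_n : nat;
  rc_adj : rel 'I_rc_n;
  rc_col : 'I_rc_n -> 'I_k;
  rc_root : 'I_rc_n }.

Definition ball_iso (T : Type) (E : set (T * T)) (k : nat) (f : T -> 'I_k)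
  (r : nat) (x : T) (H : rcgraph k) :=
  exists phi : 'I_(rc_n H) -> T,
    [/\ injective phi /\ phi (rc_root H) = x,
        (forall i, within E r x (phi i)),
        (forall y, within E r x y -> exists i, phi i = y),
        (forall i j, @rc_adj k H i j <-> E (phi i, phi j))
      & (forall i, @rc_col k H i = f (phi i))].

(** tau_r(G,f) evaluated on the set of isomorphism classes represented by Q *)
Definition tau G k r (f : gX G -> 'I_k) (Q : set (rcgraph k)) : R :=
  fine (gnu G [set x | exists H, Q H /\ ball_iso (gE G) f r x H]).

Definition tv_tau G1 G2 k r (f1 : gX G1 -> 'I_k) (f2 : gX G2 -> 'I_k) : R :=
  sup [set t | exists Q : set (rcgraph k),
                 t = `| @tau G1 k r f1 Q - @tau G2 k r f2 Q |].

Definition dH_Z G1 G2 k r : R :=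
  Num.max
    (sup [set t | exists f1, coloring f1 /\
            t = inf [set s | exists f2, coloring f2 /\ s = @tv_tau G1 G2 k r f1 f2]])
    (sup [set t | exists f2, coloring f2 /\
            t = inf [set s | exists f1, coloring f1 /\ s = @tv_tau G1 G2 k r f1 f2]]).

Definition local_global_convergent (Gs : nat -> graphing R D) :=
  forall k r : nat, (0 < k)%N -> (0 < r)%N ->
  forall eps : R, 0 < eps -> exists N : nat, forall i j : nat,
    (N <= i)%N -> (N <= j)%N -> dH_Z (Gs i) (Gs j) k r < eps.

Definition linf (n : nat) (u w : 'I_n -> R) : R :=
  \big[Num.max/0]_(j < n) `| u j - w j |.
Definition open_linf (n : nat) (U : set ('I_n -> R)) :=
  forall u, U u -> exists e : R, 0 < e /\ forall w, linf u w < e -> U w.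
Definition borel_linf (n : nat) : set (set ('I_n -> R)) :=
  <<s @open_linf n >>.
Definition enlarge (n : nat) (U : set ('I_n -> R)) (e : R) :=
  [set w | exists u, U u /\ linf u w < e].

Definition test_fun G (v : gX G -> R) :=
  measurable_fun setT (v : borel (gX G) -> R) /\ forall x, -1 <= v x <= 1.

Definition profile_map G k (v : 'I_k -> gX G -> R) (x : gX G) : 'I_(k + k) -> R :=
  fun j => match fintype.split j with
           | inl i => v i x
           | inr i => Pop (gE G) (v i) x
           end.

Definition law G k (v : 'I_k -> gX G -> R) (U : set ('I_(k + k) -> R)) : R :=
  fine (gnu G (profile_map v @^-1` U)).

Definition levy_prokhorov G1 G2 k (v1 : 'I_k -> gX G1 -> R)
  (v2 : 'I_k -> gX G2 -> R) : R :=
  inf [set e | 0 < e /\ forall U, @borel_linf (k + k) U ->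
         @law G1 k v1 U <= @law G2 k v2 (enlarge U e) + e /\
         @law G2 k v2 U <= @law G1 k v1 (enlarge U e) + e].

Definition dH_S G1 G2 k : R :=
  Num.max
    (sup [set t | exists v1, (forall i, test_fun (v1 i)) /\
            t = inf [set s | exists v2, (forall i, test_fun (v2 i)) /\
                               s = @levy_prokhorov G1 G2 k v1 v2]])
    (sup [set t | exists v2, (forall i, test_fun (v2 i)) /\
            t = inf [set s | exists v1, (forall i, test_fun (v1 i)) /\
                               s = @levy_prokhorov G1 G2 k v1 v2]]).

(** convergence in d_M: for each k the profiles form a d_H-Cauchy sequence *)
Definition action_convergent (Gs : nat -> graphing R D) :=
  forall k : nat, (0 < k)%N ->
  forall eps : R, 0 < eps -> exists N : nat, forall i j : nat,
    (N <= i)%N -> (N <= j)%N -> dH_S (Gs i) (Gs j) k < eps.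

End LocalGlobal.

(* Main.v *)
Require Import Defs.
From HB Require Import structures.
From mathcomp Require Import all_boot all_order all_algebra.
From mathcomp Require Import all_classical all_reals all_analysis.
From mathcomp Require Import measurable_realfun lra.
Import Defs.
Set Implicit Arguments. Unset Strict Implicit. Unset Printing Implicit Defensive.
Import Order.TTheory GRing.Theory Num.Theory.
Local Open Scope classical_set_scope.
Local Open Scope ring_scope.

(* Local-global convergence implies action convergence because, after rounding
   the test functions to a finite grid, the profile of a point is a function of
   its coloured 1-ball.

   Conversely, given a colouring f of G1, refine it by a measurable colouring
   with distinct colours inside every ball of radius r + 1, and label each point
   by its depth-(r + 1) colour refinement ("view").  Test functions on G2 whose
   profile approximates that of the indicators of the views round to a labelling
   of G2 with the same joint law of label and set of neighbouring labels; off a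
   set of small measure this labelling is the view of its own root colour.  So
   G2 looks locally like a covering of G1.  Coverings can only enlarge balls,
   and applying the same argument from G2 to G1 shows that the laws of the ball
   sizes nearly agree, so the covering is an isomorphism on most balls.

   All the sets involved are Borel by the Lusin-Souslin theorem: the projection
   of a Borel set with boundedly many points in each section is Borel. *)

(** * Analytic sets and Lusin separation *)

(** The operator only reports sums over neighbours, so it is fed with indicators: the sum is then a
    count, and two counts that differ by less than 1 coincide. In this way weak closeness of
    profiles becomes exact agreement of the labels around a point, provided that the point and its
    neighbours avoid an exceptional set. That set has probability at most the closeness e, and by
    invariance of the measure the points within L steps of it have probability at most (D+1)^L e.

    The depth is r + 1 because an edge between two points at distance r from the root is recognised
    by following it from one end, and its other end is a priori only known to be within r + 1.

    Measurability is an obstacle of its own. The edge set is merely Borel, so already the set of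
    points with a neighbour in a given Borel set is a projection, a priori only analytic. Bounded
    degree makes it Borel; views, ball types and the operator are reduced to this case by finite
    colourings that are injective on balls. *)

Definition agree (n : nat) (a b : nat -> nat) := forall i, (i < n)%N -> a i = b i.

(* [P] codes a set by a relation between sequences and points that behaves like
   the graph of a continuous map on a closed subset of the Baire space. *)
Definition coded (Z : topologicalType) (P : (nat -> nat) -> Z -> Prop) :=
  forall a, (forall n, exists b z, agree n a b /\ P b z) ->
  exists z, P a z /\ forall O, nbhs z O ->
    exists n, forall b z', agree n a b -> P b z' -> O z'.

(** In a Hausdorff space these are the continuous images of closed subsets of the Baire space. The
    domain may be empty, so the empty set is no special case. *)
Definition analytic (Z : topologicalType) (A : set Z) :=
  exists2 P, coded P & A = [set z | exists a, P a z].

Lemma agreeW m n a b : (m <= n)%N -> agree n a b -> agree m a b.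
Proof. by move=> mn H i im; apply: H; apply: leq_trans mn. Qed.

(** Through [pickle] one sequence carries countably many: [slice] reads them off and [glue] merges
    them, with value 0 at indices that code no pair. *)
Definition slice (n : nat) (a : nat -> nat) (i : nat) := a (pickle (n, i)).

Definition glue (s : nat -> nat -> nat) (m : nat) :=
  if unpickle m is Some (n, i) then s n i else 0%N.

Lemma slice_glue s n : slice n (glue s) = s n.
Proof. by apply/funext => i; rewrite /slice /glue pickleK. Qed.

Lemma agree_slice n k :
  exists N, forall a b, agree N a b -> agree k (slice n a) (slice n b).
Proof.
exists (\max_(i < k) (pickle (n, i : nat)).+1)%N => a b ab i ik.
by apply: ab; exact: (leq_bigmax (Ordinal ik)).
Qed.

(** The head of a code selects a member of the union and the tail codes a point of that member. *)
Lemma analytic_bigcup (Z : topologicalType) (A : nat -> set Z) :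
  (forall n, analytic (A n)) -> analytic (\bigcup_n A n).
Proof.
move=> anA.
have /choice[P HP] n : exists P, coded P /\ A n = [set z | exists a, P a z].
  by case: (anA n) => P; exists P.
exists (fun a z => P (a 0%N) (fun i => a i.+1) z); last first.
  apply/seteqP; split => [z [n _]|z [a Pa]].
    rewrite (HP n).2 => -[a Pa].
    by exists (fun i => if i is j.+1 then a j else n).
  by exists (a 0%N) => //; rewrite (HP _).2; exists (fun i => a i.+1).
move=> a Ha; have [|z [Pz Oz]] := (HP (a 0%N)).1 (fun i => a i.+1).
  move=> n; have [b [z [ab Pb]]] := Ha n.+1.
  exists (fun i => b i.+1), z; split; first by move=> i ?; exact: ab.
  by rewrite (ab 0%N).
exists z; split => // O /Oz[n nO]; exists n.+1 => b z' ab Pb.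
apply: (nO (fun i => b i.+1)); first by move=> i ?; exact: ab.
by rewrite (ab 0%N).
Qed.

(** The slices of a code are codes of one common point, one for each set. The domain stays closed
    because the limits along different slices are approximated by the same points, hence equal in a
    Hausdorff space. *)
Lemma analytic_bigcap (Z : topologicalType) (A : nat -> set Z) :
  hausdorff_space Z ->
  (forall n, analytic (A n)) -> analytic (\bigcap_n A n).
Proof.
move=> hZ anA.
have /choice[P HP] n : exists P, coded P /\ A n = [set z | exists a, P a z].
  by case: (anA n) => P; exists P.
exists (fun a z => forall n, P n (slice n a) z); last first.
  apply/seteqP; split => [z Az|z [a Pa] n _]; last first.
    by rewrite (HP _).2; exists (slice n a).
  have /choice[s Hs] n : exists a, P n a z by have := Az n I; rewrite (HP _).2.
  by exists (glue s) => n; rewrite slice_glue.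
move=> a Ha.
have /choice[z Hz] n : exists z, P n (slice n a) z /\ forall O, nbhs z O ->
    exists k, forall b z', agree k (slice n a) b -> P n b z' -> O z'.
  apply: (HP n).1 => k; have [N HN] := agree_slice n k.
  have [b [z [ab Pb]]] := Ha N; exists (slice n b), z; split => //.
  exact: HN.
have zE n : z n = z 0%N.
  apply: hZ => U1 U2 /((Hz n).2 _)[k1 H1] /((Hz 0%N).2 _)[k2 H2].
  have [N1 HN1] := agree_slice n k1; have [N2 HN2] := agree_slice 0 k2.
  have [b [y [ab Pb]]] := Ha (maxn N1 N2); exists y; split.
    by apply: (H1 _ _ _ (Pb n)); apply: HN1; apply: agreeW ab; exact: leq_maxl.
  by apply: (H2 _ _ _ (Pb 0%N)); apply: HN2; apply: agreeW ab; exact: leq_maxr.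
exists (z 0%N); split => [n|O /((Hz 0%N).2 _) [k Hk]].
  by rewrite -(zE n); exact: (Hz n).1.
have [N HN] := agree_slice 0 k; exists N => b z' ab Pb.
by apply: (Hk _ _ _ (Pb 0%N)); exact: HN.
Qed.

Lemma analytic_image (Z W : topologicalType) (f : Z -> W) (A : set Z) :
  continuous f -> analytic A -> analytic (f @` A).
Proof.
move=> cf [P cP ->]; exists (fun a w => exists2 z, P a z & f z = w).
  move=> a Ha; have [|z [Pz Hz]] := cP a.
    by move=> n; have [b [w [ab [z Pz _]]]] := Ha n; exists b, z.
  exists (f z); split; first by exists z.
  move=> O /cf /Hz[n Hn]; exists n => b w ab [y Py <-].
  exact: (Hn b).
apply/seteqP; split => [w [z [a Pa] <-]|w [a [z Pz <-]]].
  by exists a, z.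
by exists z => //; exists a.
Qed.

Lemma analyticX (Z W : topologicalType) (A : set Z) (B : set W) :
  analytic A -> analytic B -> analytic (A `*` B).
Proof.
move=> [P cP ->] [Q cQ ->].
exists (fun a z => P (slice 0 a) z.1 /\ Q (slice 1 a) z.2).
  move=> a Ha; have [|z [Pz Hz]] := cP (slice 0 a).
    move=> k; have [N HN] := agree_slice 0 k.
    have [b [z [ab [Pb _]]]] := Ha N; exists (slice 0 b), z.1; split => //.
    exact: HN.
  have [|w [Qw Hw]] := cQ (slice 1 a).
    move=> k; have [N HN] := agree_slice 1 k.
    have [b [w [ab [_ Qb]]]] := Ha N; exists (slice 1 b), w.2; split => //.
    exact: HN.
  exists (z, w); split => // O [[U1 U2] /= [nO1 nO2] sO].
  have [k1 H1] := Hz _ nO1; have [k2 H2] := Hw _ nO2.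
  have [N1 HN1] := agree_slice 0 k1; have [N2 HN2] := agree_slice 1 k2.
  exists (maxn N1 N2) => b y ab [Pb Qb]; apply: sO; split.
    by apply: (H1 _ _ _ Pb); apply: HN1; apply: agreeW ab; exact: leq_maxl.
  by apply: (H2 _ _ _ Qb); apply: HN2; apply: agreeW ab; exact: leq_maxr.
apply/seteqP; split => [z [[a Pa] [b Qb]]|z [a [Pa Qa]]]; last first.
  by split; [exists (slice 0 a)|exists (slice 1 a)].
by exists (glue (fun n => if n == 0%N then a else b)); rewrite !slice_glue.
Qed.

Definition prefix_of (s : seq nat) (b : nat -> nat) :=
  forall i, (i < size s)%N -> nth 0%N s i = b i.

(** The prefixes [s] and [t] restrict the codes to two cylinders, and one Borel set has to separate
    the images of these cylinders. *)
Definition separated_at (Z : ptopologicalType) (P Q : (nat -> nat) -> Z -> Prop)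
    (s t : seq nat) :=
  exists2 C : set (g_sigma_algebraType (@open Z)), measurable C &
  (forall z a, prefix_of s a -> P a z -> C z) /\
  (forall z b, prefix_of t b -> Q b z -> ~ C z).

Lemma prefix_of_rcons s a : prefix_of s a -> prefix_of (rcons s (a (size s))) a.
Proof.
move=> sa i; rewrite size_rcons ltnS leq_eqVlt nth_rcons => /predU1P[->|is_].
  by rewrite ltnn eqxx.
by rewrite is_; exact: sa.
Qed.

Lemma separated_at_rcons (Z : ptopologicalType) (P Q : (nat -> nat) -> Z -> Prop) s t :
  (forall n m, separated_at P Q (rcons s n) (rcons t m)) -> separated_at P Q s t.
Proof.
move=> H.
have /choice[C HC] nm :
  exists C : set (g_sigma_algebraType (@open Z)), measurable C /\
  (forall z a, prefix_of (rcons s nm.1) a -> P a z -> C z) /\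
  (forall z b, prefix_of (rcons t nm.2) b -> Q b z -> ~ C z).
  by case: (H nm.1 nm.2) => C; exists C.
exists (\bigcup_n \bigcap_m C (n, m)).
  apply: bigcupT_measurable => n; apply: bigcapT_measurable => m.
  exact: (HC _).1.
split => [z a sa Pa|z b tb Qb [n _ Cn]].
  exists (a (size s)) => // m _.
  by apply: ((HC _).2.1 _ a) => //; exact: prefix_of_rcons.
by apply: ((HC (n, b (size t))).2.2 _ b _ Qb); [exact: prefix_of_rcons|exact: Cn].
Qed.

(** If the images were inseparable, both prefixes could be extended forever without becoming
    separable. The branches [a] and [b] obtained in this way code distinct points; disjoint
    neighbourhoods of these contain the images of long enough prefixes, and so separate them after
    all. *)
Lemma coded_open_separation (Z : ptopologicalType) (P Q : (nat -> nat) -> Z -> Prop) :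
  hausdorff_space Z -> coded P -> coded Q ->
  (forall a b z, P a z -> Q b z -> False) -> separated_at P Q [::] [::].
Proof.
move=> hZ cP cQ disj; apply: contrapT => nsep.
have step (st : {st : seq nat * seq nat | ~ separated_at P Q st.1 st.2}) :
    {nm : nat * nat | ~ separated_at P Q (rcons (sval st).1 nm.1)
                                        (rcons (sval st).2 nm.2)}.
  apply: cid; apply: contrapT => H; apply: (svalP st).
  by apply: separated_at_rcons => n m; apply: contrapT => ?; apply: H; exists (n, m).
pose next st : {st : seq nat * seq nat | ~ separated_at P Q st.1 st.2} :=
  exist _ (rcons (sval st).1 (sval (step st)).1, rcons (sval st).2 (sval (step st)).2)
    (svalP (step st)).
pose S n := iter n next (exist _ ([::], [::]) nsep).
pose a n := (sval (step (S n))).1; pose b n := (sval (step (S n))).2.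
have SE n : sval (S n) = (mkseq a n, mkseq b n).
  elim: n => // n IH; rewrite !mkseqS.
  have -> : mkseq a n = (sval (S n)).1 by rewrite IH.
  by have -> : mkseq b n = (sval (S n)).2 by rewrite IH.
have nS n : ~ separated_at P Q (mkseq a n) (mkseq b n).
  by have := svalP (S n); rewrite SE.
have pre (f c : nat -> nat) n : prefix_of (mkseq f n) c -> agree n f c.
  by move=> H i iN; rewrite -(H i) ?size_mkseq// nth_mkseq.
have [|x [Pa Ox]] := cP a.
  (* If no code in use agreed with [a] up to [n], the cylinder would have empty image and [set0]
     would separate. So [a] lies in the closed domain. *)
  move=> n; apply: contrapT => H; apply: (nS n).
  exists set0; first exact: measurable0.
  split; last by move=> z c _ _; exact.
  by move=> z c /pre ac Pc; apply: H; exists c, z.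
have [|y [Qb Oy]] := cQ b.
  move=> n; apply: contrapT => H; apply: (nS n).
  exists setT; first exact: measurableT.
  split; first by [].
  by move=> z c /pre ac Qc; case: H; exists c, z.
have xy : x != y by apply/eqP => xy; apply: (disj a b x); rewrite // xy.
move: hZ; rewrite open_hausdorff => /(_ _ _ xy)[[A B]] /= [/set_mem Ax /set_mem By].
move=> [oA oB AB0].
have [n Hn] := Ox A (open_nbhs_nbhs (conj oA Ax)).
have [m Hm] := Oy B (open_nbhs_nbhs (conj oB By)).
apply: (nS (maxn n m)); exists A; first exact: sub_sigma_algebra.
split => [z c /pre ac Pc|z c /pre bc Qc Az].
  by apply: Hn Pc; apply: agreeW ac; exact: leq_maxl.
have Bz : B z by apply: Hm Qc; apply: agreeW bc; exact: leq_maxr.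
by move/eqP: AB0; rewrite -subset0 => /(_ z); apply.
Qed.

Lemma analytic_separation (Z : ptopologicalType) (A B : set Z) :
  hausdorff_space Z -> analytic A -> analytic B -> A `&` B = set0 ->
  exists2 C : set (g_sigma_algebraType (@open Z)), measurable C &
    A `<=` C /\ C `&` B = set0.
Proof.
move=> hZ [P cP ->] [Q cQ ->] AB0.
have [|C mC [PC QC]] := coded_open_separation hZ cP cQ.
  move=> a b z Pa Qb; move/seteqP: AB0 => [/(_ z) + _].
  by apply; split; [exists a|exists b].
exists C => //; split => [z [a Pa]|]; first exact: (PC z a).
by rewrite -subset0 => z [Cz [b Qb]]; exact: (QC z b).
Qed.

(** * Borel sets of a Polish space *)

Lemma natSinv_lt (R : realType) (e : R) :
  0 < e -> exists N, forall n, (N <= n)%N -> n.+1%:R^-1 < e.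
Proof.
move=> e0; have [N _ H] := near_infty_natSinv_lt (PosNum e0).
by exists N => n Nn; exact: H.
Qed.

Section Polish.
Variables (R : realType) (X : completePseudoMetricType R).
Hypothesis hX : hausdorff_space X.

Let r (n : nat) : R := n.+1%:R^-1.

Let r_gt0 n : 0 < r n. Proof. by rewrite invr_gt0. Qed.

Let r_lt (e : R) : 0 < e -> exists N, forall n, (N <= n)%N -> r n < e := @natSinv_lt R e.

Lemma dense_sequence : (exists S : set X, countable S /\ dense S) ->
  exists s : nat -> X, forall x e, 0 < e -> exists n, ball x e (s n).
Proof.
move=> [S [/countable_injP[f injf] dS]].
exists (fun n => xget point [set x | S x /\ f x = n]) => x e e0.
have [y [bxy Sy]] : (ball x e)^° `&` S !=set0.
  apply: dS; last exact: open_interior.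
  by exists x; exact: nbhsx_ballx.
exists (f y); case: xgetP => [z _ [Sz fzy]|/(_ y)]; last by case.
have -> : z = y by apply: injf; rewrite ?inE.
exact: interior_subset.
Qed.

Lemma ball_separated (x y : X) : (forall e, 0 < e -> ball x e y) -> x = y.
Proof.
move=> H; apply/eqP; apply: contrapT => /negP xy.
move: hX; rewrite ball_hausdorff => /(_ _ _ xy)[[a b] /=].
move=> /eqP; rewrite -subset0 => /(_ y); apply; split; first exact: H.
exact: ballxx.
Qed.

(** A [ball] need be neither open nor closed, so the condition that a distance is at most r is
    written as membership in the ball of radius r + e for every positive e. In this form it survives
    limits. *)
Lemma limit_of_balls (u : nat -> X) :
  (forall i j e, 0 < e -> ball (u i) (r i + r j + e) (u j)) ->
  exists y, forall i e, 0 < e -> ball (u i) (r i + e) y.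
Proof.
move=> H; have cu : cvg (u @ \oo).
  apply: cauchy_cvg; apply/cauchy_ballP => e e0.
  have e3 : 0 < e / 3 by rewrite divr_gt0.
  have [N HN] := r_lt e3.
  exists (u @` [set n | (N <= n)%N], u @` [set n | (N <= n)%N]) => /=.
    by split; exists N => // n Nn; exists n.
  move=> [_ _] /= [[i Ni <-] [j Nj <-]]; apply: le_ball (H i j _ e3).
  by have := HN _ Ni; have := HN _ Nj; lra.
have {}cu : u @ \oo --> lim (u @ \oo) by [].
exists (lim (u @ \oo)) => i e e0.
have e3 : 0 < e / 3 by rewrite divr_gt0.
have [N1 HN1] := r_lt e3.
move/cvg_ballP : cu => /(_ _ e3)[N2 _ HN2].
have := HN2 (maxn N1 N2) (leq_maxr _ _).
have := HN1 (maxn N1 N2) (leq_maxl _ _).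
set n := maxn N1 N2 => rn /= /ball_sym bn.
apply: le_ball (ball_triangle (H i n _ e3) bn).
by lra.
Qed.

Variable s : nat -> X.
Hypothesis sdense : forall x e, 0 < e -> exists n, ball x e (s n).

(** A code of z lists, for each i, the index of a dense point at distance at most [r i] from z.
    Completeness provides a point for a limit of such codes, and closedness keeps it in [A]. *)
Lemma analytic_closed (A : set X) : closed A -> analytic A.
Proof.
move=> clA.
exists (fun a z => A z /\ forall i e, 0 < e -> ball (s (a i)) (r i + e) z); last first.
  apply/seteqP; split => [z Az|z [a []//]].
  have /choice[a Ha] i : exists a, ball z (r i) (s a) by exact: sdense.
  exists a; split => // i e e0; apply: ball_sym; apply: le_ball (Ha i).
  by rewrite lerDl ltW.
move=> a Ha.
have [|y Hy] := @limit_of_balls (fun i => s (a i)).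
  move=> i j e e0; have [b [z [ab [Az Pz]]]] := Ha (maxn i j).+1.
  have e2 : 0 < e / 2 by rewrite divr_gt0.
  have key (k : nat) : (k <= maxn i j)%N -> ball (s (a k)) (r k + e / 2) z.
    by move=> km; rewrite (ab k) ?ltnS//; exact: Pz.
  have [bi bj] := (key _ (leq_maxl _ _), key _ (leq_maxr _ _)).
  by apply: le_ball (ball_triangle bi (ball_sym bj)); lra.
have near_y e : 0 < e ->
    exists n, forall z, (forall e', 0 < e' -> ball (s (a n)) (r n + e') z) -> ball y e z.
  move=> e0; have e4 : 0 < e / 4 by rewrite divr_gt0.
  have [n /(_ _ (leqnn n)) rn] := r_lt e4; exists n => z /(_ _ e4) nz.
  by apply: le_ball (ball_triangle (ball_sym (Hy n _ e4)) nz); lra.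
exists y; split; first split => //.
  apply: clA => B /nbhs_ballP[e /= e0 eB].
  have [n Hn] := near_y _ e0; have [b [z [ab [Az Pz]]]] := Ha n.+1.
  exists z; split => //; apply: eB; apply: Hn => e' e'0; rewrite ab//; exact: Pz.
move=> B /nbhs_ballP[e /= e0 eB]; have [n Hn] := near_y _ e0.
exists n.+1 => b z ab [Az Pz].
apply: eB; apply: Hn => e' e'0; rewrite ab//; exact: Pz.
Qed.

(** An open set is the countable union of those closures of basic balls that it contains. *)
Lemma analytic_open (A : set X) : open A -> analytic A.
Proof.
move=> oA.
have -> : A = \bigcup_n (if unpickle n is Some (a, m) then
    let B := closure (ball (s a) (r m)) in if `[< B `<=` A >] then B else set0
    else set0).
  apply/seteqP; split => [x Ax|x [n _]]; last first.
    by case: (unpickle n) => [[a m]|//] /=; case: asboolP => // H /H.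
  have /nbhs_ballP[e /= e0 eA] := open_nbhs_nbhs (conj oA Ax).
  have e4 : 0 < e / 4 by rewrite divr_gt0.
  have [m /(_ _ (leqnn m)) rm] := r_lt e4.
  have [a Ha] := sdense x (r_gt0 m).
  exists (pickle (a, m)) => //; rewrite pickleK /=; case: asboolP => [_|[]].
    by apply: subset_closure; exact: ball_sym.
  move=> z /(_ _ (nbhsx_ballx z _ e4))[w [aw zw]]; apply: eA.
  apply: le_ball (ball_triangle (ball_triangle Ha aw) (ball_sym zw)).
  by lra.
apply: analytic_bigcup => n; apply: analytic_closed.
case: (unpickle n) => [[a m]|]; last exact: closed0.
by rewrite /=; case: asboolP => _; [exact: closed_closure|exact: closed0].
Qed.
End Polish.

(** * Projections of Borel sets with bounded sections *)

Lemma hausdorff_prod (Z W : topologicalType) :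
  hausdorff_space Z -> hausdorff_space W -> hausdorff_space (Z * W)%type.
Proof.
move=> hZ hW [z w] [z' w'] H; congr (_, _).
  apply: hZ => A B nA nB.
  have [||[y ?] [/= [? _] [? _]]] := H (A `*` setT) (B `*` setT).
  - by exists (A, setT) => //=; split => //; exact: filterT.
  - by exists (B, setT) => //=; split => //; exact: filterT.
  - by exists y.
apply: hW => A B nA nB.
have [||[? y] [/= [_ ?] [_ ?]]] := H (setT `*` A) (setT `*` B).
- by exists (setT, A) => //=; split => //; exact: filterT.
- by exists (setT, B) => //=; split => //; exact: filterT.
- by exists y.
Qed.

Lemma measurable_prop d (T : measurableType d) (P : Prop) :
  measurable [set _ : T | P].
Proof.
case: (pselect P) => H.
  by rewrite (_ : mkset _ = setT); [exact: measurableT|apply/seteqP; split].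
by rewrite (_ : mkset _ = set0); [exact: measurable0|apply/seteqP; split].
Qed.

Section Projection.
Variables (R : realType) (X : completePseudoMetricType R).
Hypothesis hX : hausdorff_space X.
Variable s : nat -> X.
Hypothesis sdense : forall x (e : R), 0 < e -> exists n, ball x e (s n).

Let r (n : nat) : R := n.+1%:R^-1.

Let r_gt0 n : 0 < r n. Proof. by rewrite invr_gt0. Qed.

Let r_lt (e : R) : 0 < e -> exists N, forall n, (N <= n)%N -> r n < e := @natSinv_lt R e.

Lemma analyticU (Z : topologicalType) (A B : set Z) : hausdorff_space Z ->
  analytic A -> analytic B -> analytic (A `|` B).
Proof.
move=> hZ aA aB.
have -> : A `|` B = \bigcup_n (if n is 0%N then A else B).
  apply/seteqP; split => [x [|] ?|x [[|n] _ ?]]; [by exists 0%N|by exists 1%N|..].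
    by left.
  by right.
by apply: analytic_bigcup => -[|n].
Qed.

Lemma analyticI (Z : topologicalType) (A B : set Z) : hausdorff_space Z ->
  analytic A -> analytic B -> analytic (A `&` B).
Proof.
move=> hZ aA aB.
have -> : A `&` B = \bigcap_n (if n is 0%N then A else B).
  apply/seteqP; split => [x [? ?] [|n] _//|x H].
  by split; [exact: (H 0%N I)|exact: (H 1%N I)].
by apply: analytic_bigcap => // -[|n].
Qed.

(** Analytic sets are not closed under complement, so the complement is carried along; the class
    then reaches every Borel set from its generators. *)
Lemma bianalytic_sigma_algebra (Z : topologicalType) : hausdorff_space Z ->
  analytic [set: Z] -> analytic (set0 : set Z) ->
  sigma_algebra setT [set A : set Z | analytic A /\ analytic (~` A)].
Proof.
move=> hZ anT an0; split => [|A [A1 A2]|F HF].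
- by rewrite /= setC0.
- by rewrite /= setTD setCK.
- split; first by apply: analytic_bigcup => n; exact: (HF n).1.
  by rewrite setC_bigcup; apply: analytic_bigcap => // n; exact: (HF n).2.
Qed.

Lemma analytic_measurable (A : set (borel X)) : measurable A ->
  analytic (A : set X) /\ analytic (~` A : set X).
Proof.
move: A; apply: smallest_sub.
  apply: bianalytic_sigma_algebra => //; apply: (analytic_closed sdense).
    exact: closedT.
  exact: closed0.
move=> A oA; split; first exact: (analytic_open sdense).
by apply: (analytic_closed sdense); exact: open_closedC.
Qed.

Lemma analytic_measurable_prod (E : set (borel X * borel X)) :
  measurable E -> analytic (E : set (X * X)).
Proof.
have hXX := hausdorff_prod hX hX.
have anT : analytic [set: X] by apply: (analytic_closed sdense); exact: closedT.
have an0 : analytic (set0 : set X) by apply: (analytic_closed sdense); exact: closed0.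
rewrite measurable_prod_measurableType.
move=> mE; suff [] : analytic (E : set (X * X)) /\ analytic (~` E : set (X * X)) by [].
move: E mE; apply: smallest_sub.
  apply: bianalytic_sigma_algebra => //.
    by rewrite -setXTT; exact: analyticX.
  have <- : [set: X] `*` (set0 : set X) = set0 by rewrite setX0.
  exact: analyticX.
move=> _ [A mA [B mB <-]].
have [[A1 A2] [B1 B2]] := (analytic_measurable mA, analytic_measurable mB).
split; first exact: analyticX.
have -> : ~` (A `*` B) = (~` A `*` setT) `|` (setT `*` ~` B) :> set (X * X).
  apply/seteqP; split => -[x y] /=.
    by move=> /not_andP[|]; [left|right].
  by move=> [[/= nA _]|[_ /= nB]] [].
by apply: analyticU => //; exact: analyticX.
Qed.

Lemma measurable_of_opens (f : X -> X) :
  (forall O : set X, open O -> measurable (f @^-1` O : set (borel X))) ->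
  measurable_fun setT (f : borel X -> borel X).
Proof.
move=> H; refine (@measurability _ _ (borel X) (borel X) setT f (@open X) erefl _).
by move=> _ [B oB <-]; rewrite setTI; exact: H.
Qed.

Let V (p : nat * nat) : set X := (ball (s p.1) (r p.2))^°.

(* Over the set of all x with every section nonempty, the sections of the E i are
   graphs of functions; separating the analytic sets where the value lies in, or
   outside, a basic open set gives Borel functions extending them. *)
Lemma measurable_all_sections n (E : 'I_n -> set (X * X)) :
  (forall i, measurable (E i : set (borel X * borel X))) ->
  (forall x, (forall i, exists y, E i (x, y)) ->
     forall i y y', E i (x, y) -> E i (x, y') -> y = y') ->
  measurable ([set x | forall i, exists y, E i (x, y)] : set (borel X)).
Proof.
move=> mE uE; set A : set X := [set x | _].
have aproj i (B : set X) : measurable (B : set (borel X)) ->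
    analytic (fst @` (E i `&` snd @^-1` B)).
  move=> mB; apply: analytic_image; first by move=> x; exact: cvg_fst.
  apply: analytic_measurable_prod; apply: measurableI => //.
  by rewrite -[X in measurable X]setTI; exact: (measurable_snd measurableT).
have mV p : measurable (V p : set (borel X)).
  by apply: sub_sigma_algebra; exact: open_interior.
have aA : analytic A.
  have -> : A = \bigcap_k (if insub k is Some i then
      fst @` (E i `&` snd @^-1` setT) else setT).
    apply/seteqP; split => [x Ax k _|x H i].
      by case: insubP => // i _ _; have [y Ey] := Ax i; exists (x, y).
    have := H i I; rewrite valK => -[[x' y] [Ey _] /= <-].
    by exists y.
  apply: analytic_bigcap => // k; case: insubP => [i _ _|_].
    by apply: aproj; exact: measurableT.
  by apply: (analytic_closed sdense); exact: closedT.
(* Over [A] the section of [E i] is a single point. The two projections say that this point lies in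
   [V p] or outside it, so they are disjoint. *)
have sepC i p : exists C : set (borel X), measurable C /\
    forall x y, A x -> E i (x, y) -> (C x <-> V p y).
  have [||||C mC [C1 C2]] := @analytic_separation X
    (A `&` fst @` (E i `&` snd @^-1` V p)) (A `&` fst @` (E i `&` snd @^-1` ~` V p)).
  - exact: hX.
  - by apply: analyticI => //; exact: aproj.
  - by apply: analyticI => //; apply: aproj; exact: measurableC.
  - rewrite -subset0 => x0 [[Ax [[x y] /= [Ey Vy] xE]] [_ [[x' y'] /= [Ey' Vy'] xE']]].
    by apply: Vy'; rewrite xE' in Ey'; rewrite xE in Ey; rewrite (uE x0 Ax i y' y).
  exists C; split => // x y Ax Ey; split => [Cx|Vy].
    apply: contrapT => nV; move/seteqP : C2 => [/(_ x) + _]; apply; split => //.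
    by split => //; exists (x, y).
  by apply: C1; split => //; exists (x, y).
have /choice[C HC] ip : exists C : set (borel X), measurable C /\
    forall x y, A x -> E ip.1 (x, y) -> (C x <-> V ip.2 y) by exact: sepC.
have mC i p : measurable (C (i, p)) := (HC (i, p)).1.
have CV i p x y : A x -> E i (x, y) -> (C (i, p) x <-> V p y) := (HC (i, p)).2 x y.
pose close (p q : nat * nat) :=
  forall e, 0 < e -> ball (s p.1) (r p.2 + r q.2 + e) (s q.1).
(* Read [C (i, p) x] as the claim that the value at x lies in [V p]. The Borel set [good i] consists
   of the x whose claims exist at every scale and are pairwise compatible, so that by completeness
   they determine a point. *)
pose good i : set (borel X) := (\bigcap_m \bigcup_a C (i, (a, m))) `&`
  \bigcap_(pq in [set: (nat * nat) * (nat * nat)])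
    (~` C (i, pq.1) `|` ~` C (i, pq.2) `|` [set _ | close pq.1 pq.2]).
have mgood i : measurable (good i).
  apply: measurableI.
    by apply: bigcapT_measurable => m; apply: bigcupT_measurable.
  rewrite -[X in measurable X]setCK setC_bigcap; apply: measurableC.
  apply: countable_bigcupT_measurable => [|pq]; first exact: countableP.
  apply: measurableC; apply: measurableU; first by apply: measurableU; exact: measurableC.
  exact: measurable_prop.
pose clball p y := forall e, 0 < e -> ball (s p.1) (r p.2 + e) y.
have goodlim i x : good i x -> exists y, forall p, C (i, p) x -> clball p y.
  move=> [g1 g2].
  have /choice[a Ha] m : exists a, C (i, (a, m)) x by have [a _] := g1 m I; exists a.
  have cl p q : C (i, p) x -> C (i, q) x -> close p q.
    by move=> Cp Cq; case: (g2 (p, q) I) => // -[].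
  have [|y Hy] := @limit_of_balls _ _ (fun m => s (a m)).
    by move=> j k e e0; exact: (cl (a j, j) (a k, k)).
  exists y => p Cp e e0; have e3 : 0 < e / 3 by rewrite divr_gt0.
  have [m /(_ _ (leqnn m)) rm] := r_lt (divr_gt0 e3 (ltr0n _ 2)).
  have e6 : 0 < e / 3 / 2 by rewrite divr_gt0.
  have b1 := cl p (a m, m) Cp (Ha m) _ e6.
  by apply: le_ball (ball_triangle b1 (Hy m _ e6)); rewrite -/(r _) /=; lra.
pose g i x := if pselect (good i x) is left h then sval (cid (goodlim i x h)) else point.
have gP i x p : good i x -> C (i, p) x -> clball p (g i x).
  by rewrite /g; case: pselect => // h _ Cp; case: (cid _) => y /= /(_ _ Cp).
have clball_eq y z : (forall m, exists a, clball (a, m) y /\ clball (a, m) z) -> y = z.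
  move=> H; apply: ball_separated => // e e0; have e4 : 0 < e / 4 by rewrite divr_gt0.
  have [m /(_ _ (leqnn m)) rm] := r_lt e4; have [a [Hy Hz]] := H m.
  by apply: le_ball (ball_triangle (ball_sym (Hy _ e4)) (Hz _ e4)); rewrite /=; lra.
have mg i : measurable_fun setT (g i : borel X -> borel X).
  apply: measurable_of_opens => O oO.
  pose K := [set p | forall y, clball p y -> O y].
  have -> : g i @^-1` O = (good i `&` \bigcup_(p in K) C (i, p)) `|`
      (~` good i `&` [set _ | O point]).
    apply/seteqP; split => [x /= Ox|x [[gx [p Kp Cp]]|[ng Op]]].
    - case: (pselect (good i x)) => gx; [left; split => //|right; split => //].
        have /nbhs_ballP[e /= e0 eO] := open_nbhs_nbhs (conj oO Ox).
        have e4 : 0 < e / 4 by rewrite divr_gt0.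
        have [m /(_ _ (leqnn m)) rm] := r_lt e4.
        have [a _ Ca] := gx.1 m I; exists (a, m) => // y Hy; apply: eO.
        apply: le_ball (ball_triangle (ball_sym (gP _ _ _ gx Ca _ e4)) (Hy _ e4)).
        by rewrite /=; lra.
      by move: Ox; rewrite /g; case: pselect.
    - by apply: Kp; exact: gP Cp.
    - by rewrite /= /g; case: pselect.
  apply: measurableU; apply: measurableI => //.
  - rewrite bigcup_mkcond; apply: countable_bigcupT_measurable; first exact: countableP.
    by move=> p; case: ifP.
  - exact: measurableC.
  - exact: measurable_prop.
(* The functions [g i] are Borel and defined everywhere, so [A] is recovered by testing whether
   their values lie in the sections. *)
have -> : A = \bigcap_(i in [set: 'I_n]) (good i `&` (fun x => (x, g i x)) @^-1` E i).
  apply/seteqP; split => [x Ax i _|x H i]; last by have [_ ?] := H i I; exists (g i x).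
  have [y Ey] := Ax i.
  have VC p : V p y -> C (i, p) x by move/(CV i p x y Ax Ey).
  have Vball p : V p y -> clball p y.
    by move=> /interior_subset b e e0; apply: le_ball b; rewrite lerDl ltW.
  have exV m : exists a, V (a, m) y.
    have r2 : 0 < r m / 2 by rewrite divr_gt0.
    have [a Ha] := sdense y r2; exists a.
    apply/nbhs_ballP; exists (r m / 2) => // z /= yz.
    by rewrite [r m]splitr; exact: ball_triangle (ball_sym Ha) yz.
  have gx : good i x.
    split => [m _|[p q] _]; first by have [a /VC] := exV m; exists a.
    case: (pselect (C (i, p) x)) => [Cp|]; last by left; left.
    case: (pselect (C (i, q) x)) => [Cq|]; last by left; right.
    right => e e0; have e2 : 0 < e / 2 by rewrite divr_gt0.
    have /Vball /(_ _ e2) bp := (CV i p x y Ax Ey).1 Cp.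
    have /Vball /(_ _ e2) /ball_sym bq := (CV i q x y Ax Ey).1 Cq.
    by apply: le_ball (ball_triangle bp bq) => /=; lra.
  split => //=; suff -> : g i x = y by [].
  apply: clball_eq => m; have [a Va] := exV m; exists a; split; last exact: Vball.
  exact: gP (VC _ Va).
rewrite -[X in measurable X]setCK setC_bigcap; apply: measurableC.
apply: countable_bigcupT_measurable => [|i]; first exact: countableP.
 apply: measurableC; apply: measurableI => //.
rewrite -[X in measurable X]setTI.
have mpair : measurable_fun setT (fun x : borel X => ((x, g i x) : borel X * borel X)).
  exact: (@measurable_fun_pair _ _ _ (borel X) (borel X) (borel X) _ _
    (@measurable_id _ (borel X) setT) (mg i)).
exact: mpair measurableT _ (mE i).
Qed.

(** Induction on the bound. Sections with the maximal number of points are split by disjoint basic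
    open sets into single points, which is the case already settled, and there are countably many
    such splittings. Off their union [B] the sections have at least one point fewer. *)
Lemma measurable_bounded_projection D (E : set (borel X * borel X)) :
  measurable E ->
  (forall x, exists t : seq X, (size t <= D)%N /\ forall y, E (x, y) -> y \in t) ->
  measurable ([set x | exists y, E (x, y)] : set (borel X)).
Proof.
elim: D E => [|D IH] E mE sE.
  rewrite (_ : mkset _ = set0); first exact: measurable0.
  apply/seteqP; split => // x [y Ey].
  by have [t [+ /(_ y Ey)]] := sE x; rewrite leqn0 size_eq0 => /eqP ->.
have mV p : measurable (V p : set (borel X)).
  by apply: sub_sigma_algebra; exact: open_interior.
pose valid (F : {ffun 'I_D.+1 -> nat * nat}) :=
  forall i j, i != j -> V (F i) `&` V (F j) = set0.
pose A (F : {ffun 'I_D.+1 -> nat * nat}) : set (borel X) :=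
  [set x | valid F] `&` [set x | forall i, exists y, (E `&` snd @^-1` V (F i)) (x, y)].
have mA F : measurable (A F).
  case: (pselect (valid F)) => vF; last first.
    rewrite (_ : A F = set0); first exact: measurable0.
    by apply/seteqP; split => // x [].
  apply: measurableI; first exact: measurable_prop.
  apply: (@measurable_all_sections _ (fun i => E `&` snd @^-1` V (F i)))
    => [i|x Hx i y y' [Ey Vy] [Ey' Vy']].
    apply: measurableI => //; rewrite -[X in measurable X]setTI.
    exact: (measurable_snd measurableT).
  apply: contrapT => /eqP yy'; have [t [st Ht]] := sE x.
  have /choice[z Hz] := Hx.
  have Vdisj j k w : V (F j) w -> V (F k) w -> j = k.
    move=> Vj Vk; apply/eqP; apply: contrapT => /negP /vF; rewrite -subset0.
    by move/(_ w); apply.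
  (* With [y] in place of the i-th point, these [D.+1] points together with [y'] would be [D.+2]
     distinct points of one section. *)
  pose z' j := if j == i then y else z j.
  have Hz' j : E (x, z' j) /\ V (F j) (z' j).
    by rewrite /z'; case: eqP => [->//|_]; exact: Hz.
  have : (size (y' :: [seq z' j | j <- enum 'I_D.+1]) <= size t)%N.
    apply: uniq_leq_size.
      rewrite /= map_inj_uniq ?enum_uniq ?andbT; last first.
        move=> j k zjk; apply: Vdisj (Hz' j).2 _; rewrite zjk; exact: (Hz' k).2.
      apply/mapP => -[j _ y'z]; have ij : i = j.
        by apply: (Vdisj _ _ y') => //; rewrite y'z; exact: (Hz' j).2.
      by move/eqP : yy'; apply; rewrite y'z /z' -ij eqxx.
    move=> w; rewrite inE => /predU1P[->|/mapP[j _ ->]]; first exact: Ht.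
    by apply: Ht; exact: (Hz' j).1.
  by rewrite /= size_map size_enum_ord => /leq_trans/(_ st); rewrite ltnn.
pose B := \bigcup_F A F.
have mB : measurable (B : set (borel X)).
  by apply: countable_bigcupT_measurable; first exact: countableP.
pose E' := E `&` fst @^-1` ~` B.
have mE' : measurable E'.
  apply: measurableI => //; rewrite -[X in measurable X]setTI.
  by apply: (measurable_fst measurableT); exact: measurableC.
have -> : [set x | exists y, E (x, y)] = B `|` [set x | exists y, E' (x, y)].
  apply/seteqP; split => [x [y Ey]|x [[F _ [_ /(_ ord0)[y [Ey _]]]]|[y [Ey _]]]].
  - by case: (pselect (B x)) => Bx; [left|right; exists y].
  - by exists y.
  - by exists y.
apply: measurableU => //; apply: IH => // x.
case: (pselect (B x)) => Bx; first by exists [::]; split => // y [_ []].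
have [t [st Ht]] := sE x.
pose t' := undup [seq y <- t | `[< E (x, y) >]].
exists t'; split; last first.
  by move=> y [Ey _]; rewrite mem_undup mem_filter Ht// andbT; apply/asboolP.
have st' : (size t' <= D.+1)%N.
  by rewrite (leq_trans (size_undup _))// size_filter (leq_trans (count_size _ _)).
rewrite leqNgt; apply/negP => Dt'; apply: Bx.
pose z (i : 'I_D.+1) := nth point t' i.
have it' (i : 'I_D.+1) : (i < size t')%N by rewrite (leq_trans (ltn_ord i)).
have Ez i : E (x, z i).
  have := mem_nth point (it' i); rewrite -/(z i) mem_undup mem_filter.
  by move=> /andP[/asboolP].
have zz i j : z i = z j -> i = j.
  move=> /eqP; rewrite nth_uniq ?undup_uniq// => /eqP; exact: val_inj.
have /choice[N HN] (ij : 'I_D.+1 * 'I_D.+1) :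
    exists N, ij.1 != ij.2 -> ~ ball (z ij.1) (r N) (z ij.2).
  apply: contrapT => H.
  have : ij.1 != ij.2.
    apply/negP => /eqP e; apply: H; exists 0%N; by rewrite e eqxx.
  move=> /eqP; apply; apply: zz; apply: ball_separated => // e e0.
  have [n /(_ _ (leqnn n)) rn] := r_lt e0.
  apply: contrapT => nb; apply: H; exists n => _ b; apply: nb.
  by apply: le_ball b; exact: ltW.
(* A point common to two of the small balls would link [z i] to [z j] by four steps of length [r m],
   hence the factor 4. *)
have e0 : 0 < r (\max_ij N ij) / 4 by rewrite divr_gt0.
have [m /(_ _ (leqnn m)) rm] := r_lt e0.
have /choice[a Ha] i : exists a, V (a, m) (z i).
  have r2 : 0 < r m / 2 by rewrite divr_gt0.
  have [a Ha] := sdense (z i) r2; exists a.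
  apply/nbhs_ballP; exists (r m / 2) => // w /= zw.
  by rewrite [r m]splitr; exact: ball_triangle (ball_sym Ha) zw.
exists [ffun i => (a i, m)] => //; split.
  move=> i j ij; rewrite -subset0 => w; rewrite !ffunE.
  move=> -[/interior_subset wi /interior_subset wj].
  have /interior_subset zi := Ha i; have /interior_subset zj := Ha j.
  apply: (HN (i, j) ij) => /=.
  have iw := ball_triangle (ball_sym zi) wi.
  have jw := ball_triangle (ball_sym wj) zj.
  apply: le_ball (ball_triangle iw jw) => /=.
  have : r (\max_ij N ij) <= r (N (i, j)).
    by rewrite /r lef_pV2 ?posrE ?ltr0n// ler_nat ltnS; exact: leq_bigmax.
  by move: rm; rewrite /=; lra.
by move=> i; exists (z i); split => //; rewrite /= ffunE.
Qed.
End Projection.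

(** * Balls and distance colourings *)

Section Within.
Variables (T : Type) (E : set (T * T)).
Hypothesis Esym : forall x y, E (x, y) -> E (y, x).

Lemma within_refl n x : within E n x x.
Proof. by case: n => [|n]; left. Qed.

Lemma within_trans m n x y z :
  within E m x y -> within E n y z -> within E (m + n) x z.
Proof.
elim: m x => [|m IH] x; first by case=> // ->.
case=> [->|[w [Exw wy]]] yz.
  case: (n) yz => [|k]; first by case=> // ->; exact: within_refl.
  elim: k {IH} y => [|k IHk] y; case=> [->|[w [Eyw wz]]]; try exact: within_refl.
    by case: wz => // <-; right; exists w; split => //; exact: within_refl.
  by right; exists w; split => //; rewrite addnS -addSn; exact: IHk.
by right; exists w; split => //; exact: IH.
Qed.

Lemma withinW m n x y : (m <= n)%N -> within E m x y -> within E n x y.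
Proof.
by move=> /subnKC <- /within_trans; apply; exact: within_refl.
Qed.

Lemma within1 x y : E (x, y) -> within E 1 x y.
Proof. by move=> Exy; right; exists y; split => //; left. Qed.

Lemma within_sym n x y : within E n x y -> within E n y x.
Proof.
elim: n x => [|n IH] x; first by case=> // ->; left.
case=> [->|[z [Exz zy]]]; first exact: within_refl.
by rewrite -addn1; apply: within_trans (IH _ zy) _; apply: within1; exact: Esym.
Qed.

End Within.

Lemma within_finite (T : eqType) (E : set (T * T)) (D : nat) :
  (forall x, exists s : seq T, (size s <= D)%N /\ forall y, E (x, y) <-> y \in s) ->
  forall n x, exists t : seq T,
    (size t <= D.+1 ^ n)%N /\ forall y, within E n x y <-> y \in t.
Proof.
move=> deg; elim=> [|n IH] x.
  exists [:: x]; split => // y; rewrite mem_seq1.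
  by split => [[->|[]]//|/eqP ->]; left.
have [s [Ds Hs]] := deg x; have /choice[t Ht] := IH.
exists (x :: flatten [seq t z | z <- s]); split.
  apply: (@leq_trans (1 + D * D.+1 ^ n)); last by rewrite expnS mulSn leq_add2r expn_gt0.
  rewrite /= ltnS; apply: (@leq_trans (size s * D.+1 ^ n)); last by rewrite leq_mul2r Ds orbT.
  elim: (s) => //= z u IHu; rewrite size_cat mulSn leq_add//; exact: (Ht z).1.
move=> y; rewrite inE; split => [[->|[z [Exz zy]]]|/predU1P[->|/flatten_mapP[z zs zy]]].
- by rewrite eqxx.
- apply/orP; right; apply/flatten_mapP; exists z; first exact/Hs.
  exact/(Ht z).2.
- by left.
- by right; exists z; split; [exact/Hs|exact/(Ht z).2].
Qed.

Section Graphing.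
Variables (R : realType) (D : nat) (G : graphing R D).
Local Notation X := (gX G).
Local Notation E := (gE G).

Lemma measurable_nbr (S : set (borel X)) : measurable S ->
  measurable ([set x | exists y, E (x, y) /\ S y] : set (borel X)).
Proof.
move=> mS; have [s sdense] := dense_sequence (g_separable G).
have := @measurable_bounded_projection _ _ (@g_hausdorff _ _ G) _ sdense D
  (E `&` snd @^-1` S); apply.
  apply: measurableI; first exact: gE_borel.
  by rewrite -[X in measurable X]setTI; exact: (measurable_snd measurableT).
move=> x; have [t [tD Ht]] := @gE_deg _ _ G x; exists t; split => // y [Ey _].
exact/Ht.
Qed.

Lemma measurable_within n (S : set (borel X)) : measurable S ->
  measurable ([set x | exists y, within E n x y /\ S y] : set (borel X)).
Proof.
move=> mS; elim: n => [|n IH].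
  rewrite (_ : mkset _ = S)//; apply/seteqP; split => [x [y [[->|//]]]//|x Sx].
  by exists x; split => //; left.
rewrite (_ : mkset _ = S `|` [set x | exists z, E (x, z) /\
    [set x | exists y, within E n x y /\ S y] z]).
  by apply: measurableU => //; exact: measurable_nbr.
apply/seteqP; split => [x [y [[->|[z [Exz zy]]] Sy]]|x [Sx|[z [Exz [y [zy Sy]]]]]].
- by left.
- by right; exists z; split => //; exists y.
- by exists x; split => //; left.
- by exists y; split => //; right; exists z.
Qed.

(** The family consists of the interiors of balls around a dense sequence. It turns the inequality
    of two points into countably many Borel conditions. *)
Lemma measurable_base : exists W : nat -> set (borel X),
  (forall n, measurable (W n)) /\
  forall (x : X) (t : seq X), x \notin t ->
    exists n, W n x /\ forall y, y \in t -> ~ W n y.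
Proof.
have [s sdense] := dense_sequence (g_separable G).
pose r (n : nat) : R := n.+1%:R^-1.
exists (fun k => if unpickle k is Some (a, m) then (ball (s a) (r m : R))^° else set0).
split => [k|x t].
  case: (unpickle k) => [[a m]|]; last exact: measurable0.
  by apply: sub_sigma_algebra; exact: open_interior.
move=> xt.
have [m Hm] : exists m, forall y, y \in t -> ~ ball x (2 * r m) y.
  elim: t xt => [|y t IH]; first by exists 0%N.
  rewrite inE negb_or => /andP[xy /IH[m Hm]].
  have [n Hn] : exists n, ~ ball x (2 * r n) y.
    apply: contrapT => H; move/eqP : xy; apply.
    apply: (ball_separated (@g_hausdorff _ _ G)) => e e0.
    have [N _ /(_ N (leqnn N)) /= HN] :=
      near_infty_natSinv_lt (PosNum (divr_gt0 e0 (ltr0n R 2))).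
    apply: contrapT => nb; apply: H; exists N => b; apply: nb; apply: le_ball b.
    by rewrite -ler_pdivlMl ?ltr0n// mulrC; exact: ltW.
  have rle p q : (p <= q)%N -> 2 * r q <= 2 * r p.
    by move=> pq; rewrite ler_pM2l// /r lef_pV2 ?posrE ?ltr0n// ler_nat.
  exists (maxn m n) => z; rewrite inE => /predU1P[->|zt] b.
    by apply: Hn; apply: le_ball b; apply: rle; exact: leq_maxr.
  by apply: (Hm z zt); apply: le_ball b; apply: rle; exact: leq_maxl.
have r2 : 0 < r m / 2 by rewrite divr_gt0// invr_gt0.
have [a Ha] := sdense x _ r2.
exists (pickle (a, m)); rewrite pickleK; split.
  apply/nbhs_ballP; exists (r m / 2) => // w /= zw.
  by rewrite [r m]splitr; exact: ball_triangle (ball_sym Ha) zw.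
move=> y /Hm nb /interior_subset b; apply: nb.
apply: le_ball (ball_triangle Ha b).
by move: r2; lra.
Qed.

(* Greedy colouring, run simultaneously over all pairs (base set, colour): a
   point still uncoloured when (n, a) is treated takes colour a if it is isolated
   in the n-th base set and no point near it has colour a. *)
Lemma distance_coloring n : exists c : X -> 'I_(D.+1 ^ n).+1,
  coloring c /\ forall x y, within E n x y -> c x = c y -> x = y.
Proof.
set K := (D.+1 ^ n).+1.
have [W [mW sepW]] := measurable_base.
pose NH (S : set X) : set (borel X) := [set x | exists y, [/\ x <> y, within E n x y & S y]].
(* The requirement that x and y differ is witnessed by a base set that contains x but not y. *)
have mNH (S : set (borel X)) : measurable S -> measurable (NH S).
  move=> mS; rewrite (_ : NH S = \bigcup_m (W m `&`
      [set x | exists y, within E n x y /\ (S `\` W m) y])).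
    apply: bigcupT_measurable => m; apply: measurableI => //.
    by apply: measurable_within; exact: measurableD.
  apply/seteqP; split => [x [y [/eqP xy wxy Sy]]|x [m _ [Wx [y [wxy [Sy nWy]]]]]].
    have [|m [Wx nW]] := sepW x [:: y]; first by rewrite inE.
    exists m => //; split => //; exists y; split => //; split => //.
    by apply: nW; rewrite inE.
  by exists y; split => // xy; apply: nWy; rewrite -xy.
pose Cl := fix Cl k (a : 'I_K) : set (borel X) := if k is k'.+1 then
  Cl k' a `|` (if unpickle k' is Some (m, b) then
    if b == a then (W m `\` NH (W m)) `\` \bigcup_b Cl k' b `\` NH (Cl k' a) else set0
    else set0) else set0.
have mCl k a : measurable (Cl k a).
  elim: k a => [|k IH] a; first exact: measurable0.
  rewrite /=; apply: measurableU => //.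
  case: (unpickle k) => [[m b]|]; last exact: measurable0.
  case: ifP => _; last exact: measurable0.
  apply: measurableD; last exact: mNH.
  apply: measurableD; first by apply: measurableD => //; exact: mNH.
  by apply: countable_bigcupT_measurable; first exact: countableP.
have Cl_fun k a b x : Cl k a x -> Cl k b x -> a = b.
  elim: k a b => // k IH a b /= [Ha|+] [Hb|].
  - exact: IH Ha Hb.
  - case: (unpickle k) => [[m d]|//]; case: eqP => // _ [[_ H] _].
    by case: H; exists a.
  - case: (unpickle k) => [[m d]|//]; case: eqP => // _ [[_ H] _].
    by case: H; exists b.
  - by case: (unpickle k) => [[m d]|//]; case: eqP => // <- _; case: eqP.
have Cl_proper k a x y : within E n x y -> Cl k a x -> Cl k a y -> x = y.
  elim: k => // k IH wxy /= [Ha|+] [Hb|].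
  - exact: IH.
  - case: (unpickle k) => [[m d]|//]; case: eqP => // _ [_ H].
    apply: contrapT => yx; apply: H; exists x; split => //; first by move=> /esym.
    by apply: within_sym wxy; exact: gE_sym.
  - case: (unpickle k) => [[m d]|//]; case: eqP => // _ [_ H].
    by apply: contrapT => xy; apply: H; exists y.
  - case: (unpickle k) => [[m d]|//]; case: eqP => // _ [[[_ H] _] _] [[[Wy _] _] _].
    by apply: contrapT => xy; apply: H; exists y.
have Cl_mono k l a : (k <= l)%N -> Cl k a `<=` Cl l a.
  by move=> /subnKC <-; elim: (l - k)%N => [|j IH]; rewrite ?addn0// addnS => x /IH; left.
have Cl_all x : exists a k, Cl k a x.
  have [t [st Ht]] := within_finite (@gE_deg _ _ G) n x.
  have [|m [Wx nW]] := sepW x (rem x (undup t)).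
    by rewrite mem_rem_uniq ?undup_uniq// inE eqxx.
  apply: contrapT => nCl.
  have Dx : (W m `\` NH (W m)) x.
    split => // -[y [xy /Ht yt]]; apply: nW.
    rewrite mem_rem_uniq ?undup_uniq// inE mem_undup yt andbT.
    by apply/eqP => /esym.
  (* Suppose x is never coloured. When the isolating set [W m] was treated with colour a, only a
     point of colour a near x can have stopped x. Different colours give different points, and there
     is one colour more than a ball can hold points. *)
  have /choice[u Hu] a : exists y, within E n x y /\ exists k, Cl k a y.
    pose k := pickle (m, a).
    have : NH (Cl k a) x.
      apply: contrapT => nN; apply: (nCl); exists a, k.+1; rewrite /= pickleK eqxx.
      by right; split => //; split => // -[b _ Cb]; apply: nCl; exists b, k.
    by move=> [y [_ wxy Cy]]; exists y; split => //; exists k.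
  have : (size [seq u a | a <- enum 'I_K] <= size t)%N.
    apply: uniq_leq_size => [|y /mapP[a _ ->]]; last exact/Ht/(Hu a).1.
    rewrite map_inj_uniq ?enum_uniq// => a b uab.
    have [_ [k Ck]] := Hu a; have [_ [l Cl']] := Hu b.
    apply: (Cl_fun (maxn k l) a b (u a)).
      by apply: (Cl_mono k) => //; exact: leq_maxl.
    by rewrite uab; apply: (Cl_mono l) => //; exact: leq_maxr.
  by rewrite size_map size_enum_ord /K => /leq_trans/(_ st); rewrite ltnn.
have /choice[c Hc] := Cl_all.
have cE a x : c x = a <-> exists k, Cl k a x.
  split => [<-//|[k Ck]]; have [l Cx] := Hc x.
  apply: (Cl_fun (maxn k l) _ _ x).
    by apply: (Cl_mono l) => //; exact: leq_maxr.
  by apply: (Cl_mono k) => //; exact: leq_maxl.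
exists c; split => [a|x y wxy cxy].
  rewrite (_ : _ @^-1` _ = \bigcup_k Cl k a); first exact: bigcupT_measurable.
  apply/seteqP; split => [x /= /cE [k Ck]|x [k _ Ck]]; first by exists k.
  by apply/cE; exists k.
have [k Ck] := Hc x; have [l Cl'] := Hc y; rewrite -cxy in Cl'.
apply: (Cl_proper (maxn k l) (c x)) => //.
  by apply: (Cl_mono k) => //; exact: leq_maxl.
by apply: (Cl_mono l) => //; exact: leq_maxr.
Qed.
End Graphing.

(** * Colour refinement *)

(** Neighbouring views are kept as a set, without multiplicities. Where colours are distinct on
    balls this loses nothing, since distinct neighbours then have distinct views. *)
Fixpoint viewType (C : finType) (l : nat) : finType :=
  if l is l'.+1 then (viewType C l' * {set viewType C l'})%type : finType else C.

Fixpoint view (T : Type) (E : set (T * T)) (C : finType) (c : T -> C) (l : nat) :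
    T -> viewType C l :=
  match l with
  | 0 => c
  | l'.+1 => fun x => (view E c l' x,
      finset (fun t => `[< exists y, E (x, y) /\ view E c l' y = t >]))
  end.

(** The colours met in the ball of radius [l], computed from the view alone. Their number is at most
    the size of the ball, with equality exactly when the colours are distinct on it. *)
Fixpoint visible (C : finType) (l : nat) : viewType C l -> {set C} :=
  match l with
  | 0 => fun t => finset.set1 t
  | l'.+1 => fun t => finset.setU (visible t.1) (\bigcup_(s in t.2) visible s)%SET
  end.

Lemma mem_visible (T : Type) (E : set (T * T)) (C : finType) (c : T -> C) l x a :
  a \in visible (view E c l x) <-> exists2 z, within E l x z & c z = a.
Proof.
elim: l x a => [|l IH] x a /=.
  rewrite finset.in_set1; split => [/eqP ->|[z [->|//] <-]]; last exact: eqxx.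
  by exists x => //; left.
rewrite finset.in_setU; split.
  move=> /orP[/IH[z xz <-]|/bigcupP[s]].
    by exists z => //; exact: (withinW (leqnSn l) xz).
  rewrite finset.inE => /asboolP[y [Exy <-]] /IH[z yz <-].
  by exists z => //; right; exists y.
move=> [z [<-|[y [Exy yz]]] <-]; apply/orP.
  by left; apply/IH; exists x => //; exact: within_refl.
right; apply/bigcupP; exists (view E c l y); last by apply/IH; exists z.
by rewrite finset.inE; apply/asboolP; exists y.
Qed.

Section TwoViews.
Variables (T1 T2 : Type) (E1 : set (T1 * T1)) (E2 : set (T2 * T2)) (C : finType).
Variables (c1 : T1 -> C) (c2 : T2 -> C).

Lemma viewW m l x y : (l <= m)%N ->
  view E1 c1 m x = view E2 c2 m y -> view E1 c1 l x = view E2 c2 l y.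
Proof.
by move=> /subnKC <-; elim: (m - l)%N => [|k IH]; rewrite ?addn0// addnS => -[/IH].
Qed.

Lemma view_neighbor l x y x' : view E1 c1 l.+1 x = view E2 c2 l.+1 y -> E1 (x, x') ->
  exists2 y', E2 (y, y') & view E1 c1 l x' = view E2 c2 l y'.
Proof.
move=> [_ /setP /(_ (view E1 c1 l x'))]; rewrite !finset.inE => e Exx'.
have : `[< exists y', E1 (x, y') /\ view E1 c1 l y' = view E1 c1 l x' >].
  by apply/asboolP; exists x'.
by rewrite e => /asboolP[y' [? ?]]; exists y'.
Qed.

(** Each step along a path uses up one level of the view, which leaves [l] levels at its end. *)
Lemma view_within m l x y x' : view E1 c1 (m + l) x = view E2 c2 (m + l) y ->
  within E1 m x x' -> exists2 y', within E2 m y y' & view E1 c1 l x' = view E2 c2 l y'.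
Proof.
elim: m x y => [|m IH] x y xy.
  by case=> [<-|//]; exists y => //; left.
case=> [<-|[z [Exz zx']]].
  by exists y; [exact: within_refl|apply: viewW xy; exact: leq_addl].
have [w Eyw /IH /(_ zx')[y' wy' e]] := view_neighbor xy Exz.
by exists y' => //; right; exists w.
Qed.

End TwoViews.

Definition inj_ball (T : Type) (E : set (T * T)) (C : Type) (c : T -> C) n x :=
  forall y z, within E n x y -> within E n x z -> c y = c z -> y = z.

(** Colours name the points of each ball, so matching points of equal colour is well defined; the
    views guarantee that partners exist in both directions. *)
Lemma ball_iso_view (T1 T2 : Type) (E1 : set (T1 * T1)) (E2 : set (T2 * T2))
    (C : finType) (c1 : T1 -> C) (c2 : T2 -> C) k (p : C -> 'I_k) r x y (H : rcgraph k) :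
  inj_ball E1 c1 r.+1 x -> inj_ball E2 c2 r.+1 y ->
  view E1 c1 r.+1 x = view E2 c2 r.+1 y ->
  ball_iso E1 (p \o c1) r x H -> ball_iso E2 (p \o c2) r y H.
Proof.
move=> inj1 inj2 xy [phi [[phiI phir] phiB phiS phiE phiC]].
have inj2r z w : within E2 r y z -> within E2 r y w -> c2 z = c2 w -> z = w.
  by move=> ? ?; apply: inj2; exact: withinW (leqnSn r) _.
have inj1r z w : within E1 r x z -> within E1 r x w -> c1 z = c1 w -> z = w.
  by move=> ? ?; apply: inj1; exact: withinW (leqnSn r) _.
rewrite -addn1 in xy.
have /choice[psi Hpsi] i : exists y', within E2 r y y' /\
    view E1 c1 1 (phi i) = view E2 c2 1 y'.
  by have [y' ? ?] := view_within xy (phiB i); exists y'.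
have cpsi i : c1 (phi i) = c2 (psi i) := viewW (leq0n 1) (Hpsi i).2.
exists psi; split.
- split => [i j ij|].
    by apply: phiI; apply: inj1r; [exact: phiB|exact: phiB|rewrite !cpsi ij].
  apply: inj2r; [exact: (Hpsi _).1|exact: within_refl|].
  by rewrite -cpsi phir; exact: (viewW (leq0n (r + 1)) xy).
- by move=> i; exact: (Hpsi i).1.
- move=> y' yy'; have [x' xx' vx'] := view_within (esym xy) yy'.
  have [i ix'] := phiS _ xx'; exists i; apply: inj2r => //; first exact: (Hpsi i).1.
  by rewrite -cpsi ix'; exact: (esym (viewW (leq0n 1) vx')).
(* The neighbour [w] that answers to [phi j] is only known to lie within [r.+1] of [y]; injectivity
   at that radius identifies it with [psi j]. *)
- move=> i j; rewrite phiE; split => Eij.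
    have [w Ew cw] := view_neighbor (Hpsi i).2 Eij.
    have -> // : psi j = w; apply: inj2; last by rewrite -cpsi.
      by apply: withinW (leqnSn r) _; exact: (Hpsi j).1.
    by rewrite -addn1; apply: within_trans (Hpsi i).1 _; exact: within1.
  have [w Ew cw] := view_neighbor (esym (Hpsi i).2) Eij.
  have -> // : phi j = w; apply: inj1; last by rewrite cpsi.
    by apply: withinW (leqnSn r) _; exact: phiB.
  by rewrite -addn1; apply: within_trans (phiB i) _; exact: within1.
- by move=> i; rewrite phiC /= cpsi.
Qed.

(** * Measurability and mass transport in a graphing *)

Section Measure.
Variables (R : realType) (D : nat) (G : graphing R D).
Local Notation X := (gX G).
Local Notation E := (gE G).

Definition measurable_labeling (C : finType) (c : X -> C) :=
  forall a, measurable (c @^-1` [set a] : set (borel X)).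

Lemma measurable_label (C : finType) (c : X -> C) (P : set C) :
  measurable_labeling c -> measurable (c @^-1` P : set (borel X)).
Proof.
move=> mc; rewrite (_ : c @^-1` P = \bigcup_(a in P) c @^-1` [set a]); last first.
  by apply/seteqP; split => [x /= Px|x [a Pa /= ->]//]; exists (c x).
rewrite bigcup_mkcond; apply: countable_bigcupT_measurable; first exact: countableP.
by move=> a; case: ifP.
Qed.

Lemma measurable_labeling_comp (C C' : finType) (c : X -> C) (p : C -> C') :
  measurable_labeling c -> measurable_labeling (p \o c).
Proof. by move=> mc a; apply: (measurable_label (p @^-1` [set a])). Qed.

Lemma measurable_labeling_pair (C C' : finType) (c : X -> C) (c' : X -> C') :
  measurable_labeling c -> measurable_labeling c' ->
  measurable_labeling (fun x => (c x, c' x)).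
Proof.
move=> mc mc' [a a']; rewrite (_ : _ @^-1` _ = c @^-1` [set a] `&` c' @^-1` [set a']).
  exact: measurableI.
by apply/seteqP; split => x /= [-> ->].
Qed.

Lemma measurable_view (C : finType) (c : X -> C) l :
  measurable_labeling c -> measurable_labeling (view E c l).
Proof.
move=> mc; elim: l => [|l IH] //= [t S].
pose N s : set (borel X) := [set x | exists y, E (x, y) /\ view E c l y = s].
have mN s : measurable (N s) by apply: measurable_nbr; exact: IH.
rewrite (_ : _ @^-1` _ = view E c l @^-1` [set t] `&`
    \bigcap_(s in [set: viewType C l]) (if s \in S then N s else ~` N s)).
  apply: measurableI; first exact: IH.
  rewrite -[X in measurable X]setCK setC_bigcap; apply: measurableC.
  apply: countable_bigcupT_measurable => [|s]; first exact: countableP.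
  by apply: measurableC; case: ifP => _ //; exact: measurableC.
apply/seteqP; split => [x /= [<- <-]|x [/= <- H]].
  split => // s _; rewrite finset.inE; case: ifP => [/asboolP//|H /= Hs].
  by move/asboolP : H.
congr (_, _); apply/setP => s; rewrite finset.inE; have := H s I.
by case: ifP => _ Ns; apply/asboolP.
Qed.

Lemma inj_ball_coloring n (c : X -> 'I_(D.+1 ^ (n + n)).+1) :
  (forall x y, within E (n + n) x y -> c x = c y -> x = y) -> forall x, inj_ball E c n x.
Proof.
move=> H x y z xy xz cyz; apply: H => //; apply: within_trans xz.
by apply: within_sym xy; exact: gE_sym.
Qed.

(** Paired with a distance colouring, [f] yields views that determine the coloured ball, so the set
    is a union of classes of a finite Borel labelling. *)
Lemma measurable_ball_iso k (f : X -> 'I_k) r (Q : set (rcgraph k)) : coloring f ->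
  measurable ([set x | exists H, Q H /\ ball_iso E f r x H] : set (borel X)).
Proof.
move=> mf; have [c [mc Hc]] := distance_coloring G (r.+1 + r.+1).
have injc := inj_ball_coloring Hc.
set A := mkset _; pose cf x := (c x, f x).
have mcf : measurable_labeling cf by exact: measurable_labeling_pair.
rewrite (_ : A = view E cf r.+1 @^-1` (view E cf r.+1 @` A)).
  exact: measurable_label (measurable_view mcf).
apply/seteqP; split => [x Ax|x /= [y [H [QH yH]] xy]]; first by exists x.
exists H; split => //; have inj z : inj_ball E cf r.+1 z.
  by move=> u v zu zv [cuv _]; exact: (injc z).
exact: (ball_iso_view (p := snd) (inj y) (inj x) xy yH).
Qed.

Lemma neighbors_seq (x : X) : exists s : seq X, [/\ uniq s, (size s <= D)%N,
  (forall y, E (x, y) <-> y \in s) & forall v : X -> R, Pop E v x = \sum_(y <- s) v y].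
Proof.
have [t [tD Ht]] := gE_deg x; exists (undup t).
have Es y : E (x, y) <-> y \in undup t by rewrite mem_undup.
split=> [||//|v]; first exact: undup_uniq.
  exact: leq_trans (size_undup _) tD.
rewrite fsbig_seq ?undup_uniq// /Pop; congr (\sum_(y \in _) _).
by apply/seteqP; split => y /= => [/gE_sym/Es|/Es/gE_sym].
Qed.

Lemma edge_count_Pop (x : X) (S : set X) : edge_count R E x S = Pop E \1_S x.
Proof.
have [s [us _ Es ->]] := neighbors_seq x.
rewrite /edge_count (_ : mkset _ = [set` [seq y <- s | y \in S]]); last first.
  apply/seteqP; split => y /=; rewrite mem_filter.
    by move=> [/Es -> Sy]; rewrite andbT; apply/mem_set.
  by move=> /andP[/set_mem Sy /Es].
rewrite -fsbig_seq ?filter_uniq// big_filter big_mkcond; apply: eq_bigr => y _.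
by rewrite indicE; case: (y \in S).
Qed.

(** A colouring that is injective on 1-balls splits the sum into finitely many terms [w a], each the
    value of [v] at the only neighbour of colour a, or 0 if there is none. *)
Lemma measurable_Pop (v : X -> R) : measurable_fun setT (v : borel X -> R) ->
  measurable_fun setT (Pop E v : borel X -> R).
Proof.
move=> mv; have [c [mc Hc]] := distance_coloring G (1 + 1).
have injc := inj_ball_coloring Hc.
pose w a x := \sum_(y \in [set y | E (x, y) /\ c y = a]) v y.
have wE a x y : E (x, y) -> c y = a -> w a x = v y.
  move=> Exy cy; rewrite /w (_ : mkset _ = [set y]) ?fsbig_set1//.
  apply/seteqP; split => [z /= [Exz cz]|z /= ->//].
  by apply: (injc x); [exact: within1|exact: within1|rewrite cz].
have w0 a x : ~ (exists y, E (x, y) /\ c y = a) -> w a x = 0.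
  move=> H; rewrite /w (_ : mkset _ = set0) ?fsbig_set0//.
  by apply/seteqP; split => // z /= ?; apply: H; exists z.
have -> : Pop E v = fun x => \sum_a w a x.
  apply/funext => x; have [s [us _ Es ->]] := neighbors_seq x.
  rewrite (partition_big c xpredT)//=; apply: eq_bigr => a _.
  rewrite /w (_ : mkset _ = [set` [seq y <- s | c y == a]]).
    by rewrite -fsbig_seq ?filter_uniq// big_filter.
  apply/seteqP; split => y /=; rewrite mem_filter.
    by move=> [/Es -> ->]; rewrite eqxx.
  by move=> /andP[/eqP ? /Es].
apply: measurable_sum => a _ B mB; rewrite setTI.
pose Na := [set x | exists y, E (x, y) /\ (c @^-1` [set a]) y].
have mNa : measurable (Na : set (borel X)) by apply: measurable_nbr; exact: mc.
rewrite (_ : _ @^-1` _ = [set x | exists y, E (x, y) /\ (c @^-1` [set a] `&` v @^-1` B) y]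
    `|` (~` Na `&` [set _ | B 0])); last first.
  apply/seteqP; split => [x /= Bw|x [[y [Exy [cy vy]]]|[nN B0]]].
  - case: (pselect (Na x)) => [[y [Exy cy]]|nN]; [left|right; split => //].
      by exists y; split => //; split => //=; rewrite -(wE a x y).
    by rewrite -(w0 a x).
  - by rewrite /= (wE a x y).
  - by rewrite /= w0.
apply: measurableU.
  apply: measurable_nbr; apply: measurableI; first exact: mc.
  by rewrite -[X in measurable X]setTI; exact: mv.
by apply: measurableI; [exact: measurableC|exact: measurable_prop].
Qed.

Definition pr (A : set (borel X)) : R := fine (gnu G A).

Lemma prE A : measurable A -> gnu G A = (pr A)%:E.
Proof.
move=> mA; rewrite /pr fineK// ge0_fin_numE//.
by apply: le_lt_trans (probability_le1 _ mA) _; exact: ltry.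
Qed.

Lemma pr_ge0 A : 0 <= pr A. Proof. exact: fine_ge0. Qed.

Lemma pr_le1 A : measurable A -> pr A <= 1.
Proof. by move=> mA; rewrite -lee_fin -prE// probability_le1. Qed.

Lemma prT : pr setT = 1.
Proof. by apply/EFin_inj; rewrite -prE ?probability_setT//. Qed.

Lemma le_pr A B : measurable A -> measurable B -> A `<=` B -> pr A <= pr B.
Proof. by move=> mA mB AB; rewrite -lee_fin -!prE// le_measure// inE. Qed.

Lemma prC A : measurable A -> pr (~` A) = 1 - pr A.
Proof.
move=> mA; apply/EFin_inj; rewrite EFinB -!prE// ?probability_setC//.
exact: measurableC.
Qed.

Lemma prU_le A B : measurable A -> measurable B -> pr (A `|` B) <= pr A + pr B.
Proof.
move=> mA mB; rewrite -lee_fin EFinD -!prE//; last exact: measurableU.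
exact: measureU2.
Qed.

(** Mass transport: integrating over all x the number of edges into [S] gives at least the measure
    of the neighbourhood. By invariance it equals the integral of the degree over [S], which is at
    most [D] times the measure of [S]. *)
Lemma pr_nbr (S : set (borel X)) : measurable S ->
  pr [set x | exists y, E (x, y) /\ S y] <= D%:R * pr S.
Proof.
move=> mS; rewrite -lee_fin EFinM -!prE//; last exact: measurable_nbr.
have mN := measurable_nbr mS.
have mind (B : set (borel X)) : measurable B ->
    measurable_fun setT ((fun x => edge_count R E x B) : borel X -> R).
  move=> mB.
  under eq_fun do rewrite edge_count_Pop.
  by apply: measurable_Pop; exact: measurable_indic.
have := g_invariant (@measurableT _ (borel X)) mS.
set I1 := integral _ _ _; set I2 := integral _ _ _ => I12.
apply: (@le_trans _ _ I1).
  rewrite -[X in gnu G X]setIT -integral_indic//.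
  apply: ge0_le_integral => //.
  - by apply/measurable_EFinP; exact: measurable_indic.
  - by apply/measurable_EFinP; exact: mind.
  move=> x _; rewrite lee_fin edge_count_Pop; have [s [us _ Es ->]] := neighbors_seq x.
  rewrite indicE; case: (boolP (x \in _)) => [/set_mem [y [/Es ys Sy]]|_].
    rewrite (bigD1_seq y)//= indicE mem_set// lerDl.
    by apply: sumr_ge0 => z _; rewrite indicE.
  by apply: sumr_ge0 => z _; rewrite indicE.
rewrite I12 -integral_cst//; apply: ge0_le_integral => //.
- by move=> x _; rewrite lee_fin edge_count_Pop; have [s [_ _ _ ->]] := neighbors_seq x;
  apply: sumr_ge0 => z _; rewrite indicE.
- by apply/measurable_EFinP; exact: measurable_funTS (mind _ measurableT).
move=> x _; rewrite lee_fin edge_count_Pop; have [s [_ sD _ ->]] := neighbors_seq x.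
apply: (@le_trans _ _ (\sum_(y <- s) 1)).
  by apply: ler_sum => y _; rewrite indicE; case: (_ \in _).
by rewrite big_const_seq count_predT iter_addr addr0 ler_nat.
Qed.

Lemma pr_within n (S : set (borel X)) : measurable S ->
  pr [set x | exists y, within E n x y /\ S y] <= D.+1%:R ^+ n * pr S.
Proof.
move=> mS; elim: n => [|n IH].
  rewrite expr0 mul1r (_ : mkset _ = S)//.
  by apply/seteqP; split => [x [y [[->|//]]]//|x Sx]; exists x; split => //; left.
pose B := [set x | exists y, within E n x y /\ S y].
have mB : measurable (B : set (borel X)) by exact: measurable_within.
apply: (@le_trans _ _ (pr (S `|` [set x | exists z, E (x, z) /\ B z]))).
  apply: le_pr; first exact: measurable_within.
    by apply: measurableU => //; exact: measurable_nbr.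
  move=> x [y [[->|[z [Exz zy]]] Sy]]; first by left.
  by right; exists z; split => //; exists y.
apply: (le_trans (prU_le mS (measurable_nbr mB))).
have SB : pr S <= pr B.
  by apply: le_pr => // x Sx; exists x; split => //; exact: within_refl.
have := pr_nbr mB; rewrite exprS -mulrA => H.
have : D.+1%:R * pr B <= D.+1%:R * (D.+1%:R ^+ n * pr S).
  by rewrite ler_wpM2l.
by apply: le_trans; rewrite -natr1 mulrDl mul1r addrC lerD.
Qed.

End Measure.

(** * Hausdorff, Levy-Prokhorov and total variation distances *)

Section SupInf.
Variables (R : realType) (A B : Type) (P : A -> Prop) (Q : B -> Prop) (d : A -> B -> R).
Hypothesis d01 : forall a b, P a -> Q b -> 0 <= d a b <= 1.

Let S a := [set s | exists b, Q b /\ s = d a b].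

Let supinf := sup [set t | exists a, P a /\ t = inf (S a)].

Let S_lb a : P a -> has_lbound (S a).
Proof. by move=> Pa; exists 0 => s [b [Qb ->]]; case/andP: (d01 Pa Qb). Qed.

(** The bounds on [d] and the inhabitant of [Q] ensure that the real [sup] and [inf] range over
    bounded, nonempty sets and have their usual meaning. *)
Lemma sup_inf_lt e a : (exists b, Q b) -> supinf < e -> P a -> exists b, Q b /\ d a b < e.
Proof.
move=> [b0 Qb0] lte Pa.
have [||s [b [Qb ->]] sx] := @inf_lt R (S a) e; [by exists (d a b0), b0| |by exists b].
apply: le_lt_trans lte; apply: ub_le_sup; last by exists a.
exists 1 => t [a' [Pa' ->]].
apply: (@le_trans _ _ (d a' b0)); last by case/andP: (d01 Pa' Qb0).
by apply: ge_inf; [exact: S_lb|exists b0].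
Qed.

Lemma sup_inf_le e : (exists a, P a) ->
  (forall a, P a -> exists b, Q b /\ d a b <= e) -> supinf <= e.
Proof.
move=> [a0 Pa0] H; apply: ge_sup; first by exists (inf (S a0)), a0.
move=> t [a [Pa ->]]; have [b [Qb be]] := H a Pa.
by apply: le_trans be; apply: ge_inf; [exact: S_lb|exists b].
Qed.

End SupInf.

Section Linf.
Variables (R : realType) (n : nat).
Implicit Types u w v : 'I_n -> R.

Lemma linf_ltP u w e : 0 < e -> linf u w < e <-> forall j, `|u j - w j| < e.
Proof.
move=> e0; rewrite /linf; split => [H j|H].
  by apply: le_lt_trans H; exact: (le_bigmax _ (fun j => `|u j - w j|)).
by apply: bigmax_lt.
Qed.

Lemma linf_triangle u v w : linf u w <= linf u v + linf v w.
Proof.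
apply: bigmax_le => [|j _].
  by rewrite addr_ge0// /linf; exact: bigmax_ge_id.
apply: (@le_trans _ _ (`|u j - v j| + `|v j - w j|)).
  by rewrite -[u j - w j](subrKA (v j)) ler_normD.
by rewrite lerD// /linf; [exact: (le_bigmax _ (fun j => `|u j - v j|))|
  exact: (le_bigmax _ (fun j => `|v j - w j|))].
Qed.

Lemma linf_xx u : linf u u = 0.
Proof.
apply/eqP; rewrite eq_le; apply/andP; split; last exact: bigmax_ge_id.
by apply: bigmax_le => // j _; rewrite subrr normr0.
Qed.

Lemma linf_sym u w : linf u w = linf w u.
Proof. by apply: eq_bigr => j _; rewrite distrC. Qed.

Lemma open_enlarge (U : set ('I_n -> R)) e : open_linf (enlarge U e).
Proof.
move=> w [u [Uu uw]]; exists (e - linf u w); split; first by rewrite subr_gt0.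
move=> v wv; exists u; split => //.
by apply: le_lt_trans (linf_triangle u w v) _; rewrite -ltrBrDl.
Qed.

(** The Borel sets are generated by all open sets; each open set is a countable union of boxes with
    rational centre, which reduces the claim to coordinates. *)
Lemma measurable_preimage_linf d (X : measurableType d) (g : X -> 'I_n -> R) U :
  (forall i, measurable_fun setT (g ^~ i)) -> borel_linf U -> measurable (g @^-1` U).
Proof.
move=> mg; move: U; apply: smallest_sub.
  split; first by rewrite /= preimage_set0; exact: measurable0.
    by move=> A mA /=; rewrite setTD preimage_setC; exact: measurableC.
  by move=> F mF /=; rewrite preimage_bigcup; exact: bigcupT_measurable.
move=> U oU /=.
pose r (m : nat) : R := m.+1%:R^-1.
pose box (p : {ffun 'I_n -> rat} * nat) w := forall i, `|w i - ratr (p.1 i)| < r p.2.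
pose K := [set p | box p `<=` U].
rewrite (_ : g @^-1` U = \bigcup_(p in K)
    \bigcap_(i in [set: 'I_n]) [set x | `|g x i - ratr (p.1 i)| < r p.2]).
  rewrite bigcup_mkcond; apply: countable_bigcupT_measurable; first exact: countableP.
  move=> p; case: ifP => // _.
  rewrite -[X in measurable X]setCK setC_bigcap; apply: measurableC.
  apply: countable_bigcupT_measurable; first exact: countableP.
  move=> i; apply: measurableC.
  have -> : [set x | `|g x i - ratr (p.1 i)| < r p.2] = setT `&` (g ^~ i) @^-1`
      `](ratr (p.1 i) - r p.2), (ratr (p.1 i) + r p.2)[.
    rewrite setTI; apply/seteqP.
    by split => x /=; rewrite in_itv/= ltr_distl.
  exact: (mg i).
apply/seteqP; split => [x /= Ux|x [p pK H]]; last by apply: pK => i; exact: H.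
have [e [e0 He]] := oU _ Ux.
have [m _ /(_ m (leqnn m)) /= rm] := near_infty_natSinv_lt (PosNum (divr_gt0 e0 (ltr0n R 2))).
have r0 : 0 < r m by rewrite invr_gt0.
have /choice[q Hq] i : exists q : rat, `|g x i - ratr q| < r m.
  have [|q] := @rat_in_itvoo R (g x i - r m) (g x i + r m).
    by rewrite ltrBlDr -addrA ltrDl addr_gt0.
  by rewrite in_itv /= => qi; exists q; rewrite distrC ltr_distl.
exists ([ffun i => q i], m) => [w Hw|i _ /=]; last by rewrite ffunE.
apply: He; apply/linf_ltP => // i; have := Hw i; rewrite /= ffunE => wi.
rewrite -[g x i - w i](subrKA (ratr (q i))).
apply: le_lt_trans (ler_normD _ _) _; rewrite [`|ratr _ - _|]distrC.
by rewrite [e]splitr ltrD//; [exact: lt_trans (Hq i) rm|exact: lt_trans wi rm].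
Qed.

Lemma open_borel_linf (U : set ('I_n -> R)) : open_linf U -> borel_linf U.
Proof. exact: sub_sigma_algebra. Qed.

End Linf.

Section Law.
Variables (R : realType) (D : nat).
Implicit Types G : graphing R D.

Lemma measurable_profile G k (v : 'I_k -> gX G -> R) U :
  (forall i, test_fun (v i)) -> borel_linf U ->
  measurable (profile_map v @^-1` U : set (borel (gX G))).
Proof.
move=> tv; apply: (@measurable_preimage_linf _ _ _ (borel (gX G))) => i.
rewrite /profile_map; case: (fintype.split i) => j; first exact: (tv j).1.
by apply: measurable_Pop; exact: (tv j).1.
Qed.

Definition levy_le G1 G2 k (v1 : 'I_k -> gX G1 -> R) (v2 : 'I_k -> gX G2 -> R) e :=
  forall U, @borel_linf R (k + k) U ->
    law v1 U <= law v2 (enlarge U e) + e /\ law v2 U <= law v1 (enlarge U e) + e.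

Variables (G1 G2 : graphing R D) (k : nat).
Variables (v1 : 'I_k -> gX G1 -> R) (v2 : 'I_k -> gX G2 -> R).
Hypotheses (t1 : forall i, test_fun (v1 i)) (t2 : forall i, test_fun (v2 i)).

Lemma levy_le1 : levy_le v1 v2 1.
Proof.
move=> U bU; split.
  apply: (@le_trans _ _ 1); first exact: pr_le1 (measurable_profile t1 bU).
  by rewrite lerDr; exact: pr_ge0.
apply: (@le_trans _ _ 1); first exact: pr_le1 (measurable_profile t2 bU).
by rewrite lerDr; exact: pr_ge0.
Qed.

Lemma levy_prokhorov_le e : 0 < e -> levy_le v1 v2 e -> levy_prokhorov v1 v2 <= e.
Proof. by move=> e0 H; apply: ge_inf => //; exists 0 => x [/ltW]. Qed.

Lemma levy_prokhorov01 : 0 <= levy_prokhorov v1 v2 <= 1.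
Proof.
apply/andP; split; last exact: levy_prokhorov_le levy_le1.
apply: lb_le_inf; last by move=> x [/ltW].
by exists 1; split; [exact: ltr01|exact: levy_le1].
Qed.

Lemma levy_prokhorov_lt e : levy_prokhorov v1 v2 < e ->
  exists2 e', 0 < e' < e & levy_le v1 v2 e'.
Proof.
move=> /inf_lt[|e' [e'0 H] lt]; first by exists 1; split; [exact: ltr01|exact: levy_le1].
by exists e' => //; rewrite e'0.
Qed.

End Law.

Section TotalVariation.
Variables (R : realType) (D : nat) (G1 G2 : graphing R D) (k r : nat).
Variables (f1 : gX G1 -> 'I_k) (f2 : gX G2 -> 'I_k).
Hypotheses (c1 : coloring f1) (c2 : coloring f2).

Let dist Q : 0 <= `|tau r f1 Q - tau r f2 Q| <= 1.
Proof.
have m1 := measurable_ball_iso r Q c1; have m2 := measurable_ball_iso r Q c2.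
rewrite normr_ge0 /=; have := pr_le1 m1; have := pr_le1 m2.
have := pr_ge0 [set x | exists H, Q H /\ ball_iso (gE G1) f1 r x H].
have := pr_ge0 [set x | exists H, Q H /\ ball_iso (gE G2) f2 r x H].
by rewrite /pr -/(tau r f1 Q) -/(tau r f2 Q) ler_norml; lra.
Qed.

Lemma tv_tau_le e : (forall Q, `|tau r f1 Q - tau r f2 Q| <= e) -> tv_tau r f1 f2 <= e.
Proof.
by move=> H; apply: ge_sup => [|t [Q ->]//]; exists `|tau r f1 set0 - tau r f2 set0|, set0.
Qed.

Lemma le_tv_tau Q : `|tau r f1 Q - tau r f2 Q| <= tv_tau r f1 f2.
Proof.
apply: ub_le_sup; last by exists Q.
by exists 1 => t [Q' ->]; case/andP: (dist Q').
Qed.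

Lemma tv_tau01 : 0 <= tv_tau r f1 f2 <= 1.
Proof.
apply/andP; split; last by apply: tv_tau_le => Q; case/andP: (dist Q).
by apply: le_trans (le_tv_tau set0); case/andP: (dist set0).
Qed.

End TotalVariation.

(** * Local-global convergence implies action convergence *)

Section Discretization.
Variables (R : realType) (D : nat).
Implicit Types G : graphing R D.

Lemma measurable_labeling_ffun G (I C : finType) (c : I -> gX G -> C) :
  (forall i, measurable_labeling (c i)) -> measurable_labeling (fun x => [ffun i => c i x]).
Proof.
move=> mc a; rewrite (_ : _ @^-1` _ = \bigcap_(i in [set: I]) c i @^-1` [set a i]).
  rewrite -[X in measurable X]setCK setC_bigcap; apply: measurableC.
  apply: countable_bigcupT_measurable => [|i]; first exact: countableP.
  by apply: measurableC; exact: mc.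
apply/seteqP; split => [x /= <- i _ /=|x H /=]; first by rewrite ffunE.
by apply/ffunP => i; rewrite ffunE; exact: H.
Qed.

Lemma measurable_fun_label G (C : finType) (c : gX G -> C) (h : C -> R) :
  measurable_labeling c -> measurable_fun setT (h \o c : borel (gX G) -> R).
Proof. by move=> mc _ B mB; rewrite setTI; exact: (measurable_label (h @^-1` B)). Qed.

Lemma measurable_test_fun_itv G (v : gX G -> R) a b :
  test_fun v -> measurable_labeling (fun x => a <= v x <= b).
Proof.
move=> [mv _]; have mab : measurable ([set x | a <= v x <= b] : set (borel (gX G))).
  have -> : [set x | a <= v x <= b] = setT `&` v @^-1` `[a, b].
    by rewrite setTI; apply/seteqP; split => x /=; rewrite in_itv.
  by apply: mv => //; exact: measurable_itv.
case.
  by rewrite (_ : _ @^-1` _ = [set x | a <= v x <= b]).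
rewrite (_ : _ @^-1` _ = ~` [set x | a <= v x <= b]); first exact: measurableC.
by apply/seteqP; split => x /= => [->|/negP/negbTE].
Qed.

Lemma grid_point m (x : R) : -1 <= x <= 1 ->
  exists i : 'I_m.+1, -1 + i%:R * (2 / m.+1%:R) <= x <= -1 + i.+1%:R * (2 / m.+1%:R).
Proof.
move=> /andP[x1 x2]; set d := 2 / m.+1%:R.
have d0 : 0 < d by rewrite divr_gt0.
have dm : m.+1%:R * d = 2 by rewrite mulrC divfK// pnatr_eq0.
have [j jm Hj] : exists2 j, (j <= m)%N & x <= -1 + j.+1%:R * d.
  by exists m => //; rewrite dm; lra.
pose P j := (x <= -1 + j.+1%:R * d).
have exP : exists j, P j by exists j.
case: (ex_minnP exP) => i Pi imin.
have im : (i < m.+1)%N by rewrite ltnS (leq_trans _ jm)// imin.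
exists (Ordinal im); apply/andP; split; last exact: Pi.
case: i Pi imin im => [|i] _ imin im; first by rewrite /= mul0r addr0.
by rewrite /= leNgt; apply/negP => lt; have := imin i (ltW lt); rewrite ltnn.
Qed.

(** [K] and [h] are fixed before the graphing, so a single number of colours serves the whole
    sequence. *)
Lemma discretization k (e : R) : 0 < e -> exists (K : nat) (h : 'I_k -> 'I_K -> R),
  [/\ (0 < K)%N, forall l c, -1 <= h l c <= 1 &
   forall G (v : 'I_k -> gX G -> R), (forall l, test_fun (v l)) ->
     exists f : gX G -> 'I_K, coloring f /\ forall l x, `|v l x - h l (f x)| <= e].
Proof.
move=> e0.
have [m _ /(_ m (leqnn m)) /= me] := near_infty_natSinv_lt (PosNum (divr_gt0 e0 (ltr0n R 2))).
pose d : R := 2 / m.+1%:R.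
have d0 : 0 < d by rewrite divr_gt0.
have de : d <= e by rewrite /d mulrC -ler_pdivlMr// ltW.
have dm : m.+1%:R * d = 2 by rewrite mulrC divfK// pnatr_eq0.
pose C : finType := {ffun 'I_k -> {ffun 'I_m.+1 -> bool}}.
pose g (b : {ffun 'I_m.+1 -> bool}) : R := -1 + (odflt ord0 [pick i | b i])%:R * d.
have c0 : C := [ffun _ => [ffun _ => false]].
exists #|C|, (fun l (c : 'I_#|C|) => g ((enum_val c : {ffun _ -> _}) l)); split.
- by apply/card_gt0P; exists c0.
- move=> l c; rewrite /g; move: (odflt _ _) => i.
  have : i%:R * d <= 2 by rewrite -dm ler_pM2r// ler_nat ltnW.
  have : 0 <= i%:R * d by rewrite mulr_ge0// ltW.
  by lra.
move=> G v tv.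
(* Closed cells share endpoints, so the colour records every cell containing the value, and [g]
   selects one of them afterwards. *)
pose f x : C := [ffun l => [ffun i : 'I_m.+1 => -1 + i%:R * d <= v l x <= -1 + i.+1%:R * d]].
have mf : measurable_labeling f.
  apply: measurable_labeling_ffun => l; apply: measurable_labeling_ffun => i.
  exact: measurable_test_fun_itv.
exists (enum_rank \o f); split; first exact: measurable_labeling_comp.
move=> l x; rewrite /= enum_rankK /f ffunE /g.
case: pickP => [i|H] /=; last first.
  by have [i Hi] := grid_point m ((tv l).2 x); have := H i; rewrite ffunE Hi.
rewrite ffunE -natr1 mulrDl mul1r => Hi; rewrite ler_norml; move: Hi de.
by move: (i%:R * d) => z; lra.
Qed.

Lemma Pop_dist G (u v : gX G -> R) (e : R) x : 0 <= e ->
  (forall y, gE G (x, y) -> `|u y - v y| <= e) ->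
  `|Pop (gE G) u x - Pop (gE G) v x| <= D%:R * e.
Proof.
move=> e0 H; have [s [_ sD Es Hs]] := neighbors_seq x.
rewrite !Hs -sumrB; apply: le_trans (ler_norm_sum _ _ _) _.
apply: (@le_trans _ _ (\sum_(y <- s) e)).
  by rewrite big_seq [leRHS]big_seq; apply: ler_sum => y ys; exact/H/Es.
rewrite big_const_seq count_predT iter_addr addr0 mulr_natl.
exact: ler_wpMn2l.
Qed.

Lemma linf_profile G k (u v : 'I_k -> gX G -> R) (e e' : R) x : 0 <= e ->
  D.+1%:R * e < e' ->
  (forall l, `|u l x - v l x| <= e) ->
  (forall l y, gE G (x, y) -> `|u l y - v l y| <= e) ->
  linf (profile_map u x) (profile_map v x) < e'.
Proof.
move=> e0 ee' H Hn.
have De : 0 <= D%:R * e by rewrite mulr_ge0.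
have {}ee' : D%:R * e + e < e' by rewrite -[X in _ + X]mul1r -mulrDl natr1.
apply/linf_ltP => [|j]; first by lra.
rewrite /profile_map; case: (fintype.split j) => l.
  by apply: le_lt_trans (H l) _; lra.
by apply: le_lt_trans (Pop_dist e0 (Hn l)) _; lra.
Qed.

Lemma ball_iso_exists G k (f : gX G -> 'I_k) r x : exists H, ball_iso (gE G) f r x H.
Proof.
have [t [_ Ht]] := within_finite (@gE_deg _ _ G) r x.
pose s := undup t.
have xs : (index x s < size s)%N.
  by rewrite index_mem mem_undup; apply/Ht; exact: within_refl.
pose phi (i : 'I_(size s)) := nth x s i.
have phis i : phi i \in s by apply: mem_nth.
exists (RCGraph (fun i j => `[< gE G (phi i, phi j) >]) (f \o phi) (Ordinal xs)).
exists phi; split => //.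
- split; last by rewrite /phi /= nth_index// -index_mem.
  move=> i j /eqP; rewrite nth_uniq ?undup_uniq// => /eqP; exact: val_inj.
- by move=> i; apply/Ht; rewrite -mem_undup.
- move=> y /Ht; rewrite -mem_undup -/s => ys.
  have ys' : (index y s < size s)%N by rewrite index_mem.
  by exists (Ordinal ys'); rewrite /phi /= nth_index.
- by move=> i j; split => /asboolP.
Qed.

Lemma Pop_ball_iso G k (f : gX G -> 'I_k) (h : 'I_k -> R) x H :
  ball_iso (gE G) f 1 x H ->
  Pop (gE G) (h \o f) x = \sum_(i | rc_adj (rc_root H) i) h (rc_col i).
Proof.
move=> [phi [[phiI phir] phiB phiS phiE phiC]].
pose s := [seq phi i | i <- enum 'I_(rc_n H) & rc_adj (rc_root H) i].
rewrite /Pop (_ : mkset _ = [set` s]).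
  rewrite -fsbig_seq ?big_map ?big_filter ?big_enum_cond/=.
    by apply: eq_bigr => i _; rewrite phiC.
  by rewrite map_inj_uniq// filter_uniq// enum_uniq.
apply/seteqP; split => y /=.
  move=> /gE_sym Exy; have [i iy] := phiS y (within1 Exy).
  by apply/mapP; exists i => //; rewrite mem_filter mem_enum andbT phiE phir iy.
move=> /mapP[i]; rewrite mem_filter => /andP[+ _] ->.
by rewrite phiE phir => /gE_sym.
Qed.

Lemma profile_ball_iso G1 G2 k K (h : 'I_k -> 'I_K -> R)
    (f1 : gX G1 -> 'I_K) (f2 : gX G2 -> 'I_K) x y H :
  ball_iso (gE G1) f1 1 x H -> ball_iso (gE G2) f2 1 y H ->
  profile_map (fun l => h l \o f1) x = profile_map (fun l => h l \o f2) y.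
Proof.
move=> xH yH; apply/funext => j; rewrite /profile_map; case: (fintype.split j) => l.
  move: xH yH => [phi [[_ <-] _ _ _ phiC]] [psi [[_ <-] _ _ _ psiC]].
  by rewrite /= -phiC -psiC.
by rewrite (Pop_ball_iso _ xH) (Pop_ball_iso _ yH).
Qed.

Lemma levy_le_sym G1 G2 k (v1 : 'I_k -> gX G1 -> R) (v2 : 'I_k -> gX G2 -> R) e :
  levy_le v1 v2 e -> levy_le v2 v1 e.
Proof. by move=> H U /H[]. Qed.

Lemma tv_tau_sym G1 G2 k r (f1 : gX G1 -> 'I_k) (f2 : gX G2 -> 'I_k) :
  tv_tau r f1 f2 = tv_tau r f2 f1.
Proof.
by congr sup; apply/seteqP; split => t [Q ->]; exists Q; rewrite distrC.
Qed.

Lemma test_fun_label G (C : finType) (c : gX G -> C) (h : C -> R) :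
  measurable_labeling c -> (forall a, -1 <= h a <= 1) -> test_fun (h \o c).
Proof. by move=> mc h1; split => [|x]; [exact: measurable_fun_label|exact: h1]. Qed.

(** A set of profiles is replaced by the set [Q] of coloured 1-balls occurring over it, whose
    probabilities are compared by total variation. Rounding is needed on the first graphing only and
    is absorbed by the enlargement. *)
Lemma levy_le_tv G1 G2 k K (v : 'I_k -> gX G1 -> R) (h : 'I_k -> 'I_K -> R)
    (f1 : gX G1 -> 'I_K) (f2 : gX G2 -> 'I_K) (e e' : R) :
  0 <= e -> D.+1%:R * e < e' -> (forall l, test_fun (v l)) ->
  (forall l c, -1 <= h l c <= 1) -> coloring f1 -> coloring f2 ->
  (forall l x, `|v l x - h l (f1 x)| <= e) -> tv_tau 1 f1 f2 < e' ->
  levy_le v (fun l => h l \o f2) e'.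
Proof.
move=> e0 ee' tv h1 cf1 cf2 vh tvf.
pose u l := h l \o f1; pose w l := h l \o f2.
have tu l : test_fun (u l) by exact: test_fun_label.
have tw l : test_fun (w l) by exact: test_fun_label.
have uv x : linf (profile_map v x) (profile_map u x) < e'.
  by apply: (linf_profile e0 ee') => [l|l y _]; exact: vh.
have tauQ Q : tau 1 f1 Q <= tau 1 f2 Q + e' /\ tau 1 f2 Q <= tau 1 f1 Q + e'.
  have := le_lt_trans (le_tv_tau 1 cf1 cf2 Q) tvf; rewrite ltr_norml.
  by move=> /andP[? ?]; split; lra.
have mf1 Q := measurable_ball_iso 1 Q cf1.
have mf2 Q := measurable_ball_iso 1 Q cf2.
move=> U bU; have bUe : borel_linf (enlarge U e').
  by apply: open_borel_linf; exact: open_enlarge.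
split.
  pose Q := [set H | exists x, U (profile_map v x) /\ ball_iso (gE G1) f1 1 x H].
  apply: (@le_trans _ _ (tau 1 f1 Q)).
    apply: le_pr => //; first exact: measurable_profile.
    move=> x /= Ux; have [H xH] := ball_iso_exists f1 1 x.
    by exists H; split => //; exists x.
  apply: (le_trans (tauQ Q).1); rewrite lerD2r.
  apply: le_pr => //; first exact: measurable_profile.
  move=> y [H [[x [Ux xH]] yH]]; exists (profile_map v x); split => //.
  by rewrite -(profile_ball_iso h xH yH); exact: uv.
pose Q := [set H | exists y, U (profile_map w y) /\ ball_iso (gE G2) f2 1 y H].
apply: (@le_trans _ _ (tau 1 f2 Q)).
  apply: le_pr => //; first exact: measurable_profile.
  move=> y /= Uy; have [H yH] := ball_iso_exists f2 1 y.
  by exists H; split => //; exists y.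
apply: (le_trans (tauQ Q).2); rewrite lerD2r.
apply: le_pr => //; first exact: measurable_profile.
move=> x [H [[y [Uy yH]] xH]]; exists (profile_map w y); split => //.
by rewrite -(profile_ball_iso h xH yH) linf_sym; exact: uv.
Qed.

Lemma coloring_exists G k : (0 < k)%N -> exists f : gX G -> 'I_k, coloring f.
Proof.
by move=> k0; exists (fun=> Ordinal k0) => i; exact: measurable_prop.
Qed.

Lemma test_funs_exists G k : exists v : 'I_k -> gX G -> R, forall i, test_fun (v i).
Proof.
exists (fun _ _ => 0) => i; split => [|x]; first exact: measurable_cst.
by rewrite lerN10 ler01.
Qed.

Lemma dH_Z_lt G1 G2 k r e : (0 < k)%N -> dH_Z G1 G2 k r < e ->
  (forall f1 : gX G1 -> 'I_k, coloring f1 ->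
     exists f2 : gX G2 -> 'I_k, coloring f2 /\ tv_tau r f1 f2 < e) /\
  (forall f2 : gX G2 -> 'I_k, coloring f2 ->
     exists f1 : gX G1 -> 'I_k, coloring f1 /\ tv_tau r f1 f2 < e).
Proof.
move=> k0; rewrite /dH_Z gt_max => /andP[lt1 lt2]; split => [f1 c1|f2 c2].
  apply: (sup_inf_lt _ _ lt1 c1); last exact: coloring_exists.
  by move=> ? ?; exact: tv_tau01.
apply: (@sup_inf_lt _ _ _ _ _ (fun f2 f1 => tv_tau r f1 f2) _ _ _ _ lt2 c2).
  by move=> f f' ? ?; exact: tv_tau01.
exact: coloring_exists.
Qed.

Lemma dH_Z_le G1 G2 k r e : (0 < k)%N ->
  (forall f1 : gX G1 -> 'I_k, coloring f1 ->
     exists f2 : gX G2 -> 'I_k, coloring f2 /\ tv_tau r f1 f2 <= e) ->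
  (forall f2 : gX G2 -> 'I_k, coloring f2 ->
     exists f1 : gX G1 -> 'I_k, coloring f1 /\ tv_tau r f1 f2 <= e) ->
  dH_Z G1 G2 k r <= e.
Proof.
move=> k0 H1 H2; rewrite /dH_Z ge_max; apply/andP; split; apply: sup_inf_le => //.
- by move=> f f' ? ?; exact: tv_tau01.
- exact: coloring_exists.
- by move=> f f' ? ?; exact: tv_tau01.
- exact: coloring_exists.
Qed.

Lemma dH_S_lt G1 G2 k e : dH_S G1 G2 k < e ->
  (forall v1 : 'I_k -> gX G1 -> R, (forall i, test_fun (v1 i)) ->
     exists v2 : 'I_k -> gX G2 -> R, (forall i, test_fun (v2 i)) /\ levy_prokhorov v1 v2 < e) /\
  (forall v2 : 'I_k -> gX G2 -> R, (forall i, test_fun (v2 i)) ->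
     exists v1 : 'I_k -> gX G1 -> R, (forall i, test_fun (v1 i)) /\ levy_prokhorov v1 v2 < e).
Proof.
rewrite /dH_S gt_max => /andP[lt1 lt2]; split => [v1 t1|v2 t2].
  apply: (sup_inf_lt _ _ lt1 t1); last exact: test_funs_exists.
  by move=> ? ? ? ?; exact: levy_prokhorov01.
apply: (@sup_inf_lt _ _ _ _ _ (fun v2 v1 => levy_prokhorov v1 v2) _ _ _ _ lt2 t2).
  by move=> ? ? ? ?; exact: levy_prokhorov01.
exact: test_funs_exists.
Qed.

Lemma dH_S_le G1 G2 k e :
  (forall v1 : 'I_k -> gX G1 -> R, (forall i, test_fun (v1 i)) ->
     exists v2 : 'I_k -> gX G2 -> R, (forall i, test_fun (v2 i)) /\ levy_prokhorov v1 v2 <= e) ->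
  (forall v2 : 'I_k -> gX G2 -> R, (forall i, test_fun (v2 i)) ->
     exists v1 : 'I_k -> gX G1 -> R, (forall i, test_fun (v1 i)) /\ levy_prokhorov v1 v2 <= e) ->
  dH_S G1 G2 k <= e.
Proof.
move=> H1 H2; rewrite /dH_S ge_max; apply/andP; split; apply: sup_inf_le => //.
- by move=> ? ? ? ?; exact: levy_prokhorov01.
- exact: test_funs_exists.
- by move=> ? ? ? ?; exact: levy_prokhorov01.
- exact: test_funs_exists.
Qed.

Lemma local_global_action (Gs : nat -> graphing R D) :
  local_global_convergent Gs -> action_convergent Gs.
Proof.
move=> lgc k k0 eps eps0.
have e20 : 0 < eps / 2 by rewrite divr_gt0.
(* With [D.+2] instead of [D.+1] the bound [ee] is strict, as the enlargement requires. *)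
pose e := eps / 2 / D.+2%:R.
have e0 : 0 < e by rewrite divr_gt0.
have ee : D.+1%:R * e < eps / 2.
  by rewrite /e mulrCA gtr_pMr// ltr_pdivrMr ?ltr0n// mul1r ltr_nat.
have [K [h [K0 h1 disc]]] := discretization k e0.
have [N HN] := lgc K 1%N K0 isT _ e20.
exists N => i j Ni Nj; apply: (@le_lt_trans _ _ (eps / 2)); last by lra.
have [H1 H2] := dH_Z_lt K0 (HN i j Ni Nj).
apply: dH_S_le => [v1 t1|v2 t2].
  have [f1 [c1 vh]] := disc _ _ t1; have [f2 [c2 tv]] := H1 f1 c1.
  have t2 l : test_fun (h l \o f2) by exact: test_fun_label.
  exists (fun l => h l \o f2); split => //.
  by apply: levy_prokhorov_le => //; exact: (levy_le_tv (ltW e0) ee t1 h1 c1 c2 vh tv).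
have [f2 [c2 vh]] := disc _ _ t2; have [f1 [c1 tv]] := H2 f2 c2.
have t1 l : test_fun (h l \o f1) by exact: test_fun_label.
exists (fun l => h l \o f1); split => //.
apply: levy_prokhorov_le => //; apply: levy_le_sym.
by rewrite tv_tau_sym in tv; exact: (levy_le_tv (ltW e0) ee t2 h1 c2 c1 vh tv).
Qed.

End Discretization.

(** * Action convergence implies local-global convergence *)

Fixpoint rootColor (C : finType) (l : nat) : viewType C l -> C :=
  match l with
  | 0 => fun t => t
  | l'.+1 => fun t => rootColor t.1
  end.

Lemma rootColor_view (T : Type) (E : set (T * T)) (C : finType) (c : T -> C) l x :
  rootColor (view E c l x) = c x.
Proof. by elim: l. Qed.

Lemma natr_dist_lt1 (R : realType) (n m : nat) : `|n%:R - m%:R : R| < 1 -> n = m.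
Proof.
rewrite ltr_norml => /andP[h1 h2]; case: (ltngtP n m) => // lt.
  have : n%:R + 1 <= m%:R :> R by rewrite natr1 ler_nat.
  by move=> ?; exfalso; lra.
have : m%:R + 1 <= n%:R :> R by rewrite natr1 ler_nat.
by move=> ?; exfalso; lra.
Qed.

Section Transfer.
Variables (R : realType) (D : nat).
Implicit Types G : graphing R D.

Lemma Pop_indicator G (a : gX G -> bool) x :
  exists n : nat, Pop (gE G) (fun y => (a y)%:R : R) x = n%:R /\
    ((0 < n)%N <-> exists2 y, gE G (x, y) & a y).
Proof.
have [s [_ _ Es Hs]] := neighbors_seq x.
exists (count a s); split; first by
  rewrite Hs -natr_sum -sum1_count [in RHS]big_mkcond; congr (_%:R);
  apply: eq_bigr => y _; case: (a y).
rewrite -has_count; split => [/hasP[y ys ay]|[y /Es ys ay]].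
  by exists y => //; exact/Es.
by apply/hasP; exists y.
Qed.

Variables (G1 G2 : graphing R D) (C : finType) (L : nat).
Variable c1 : gX G1 -> C.
Hypothesis mc1 : measurable_labeling c1.
Let V := viewType C L.
Let V1 : gX G1 -> V := view (gE G1) c1 L.

Definition view_test (t : 'I_#|V|) (x : gX G1) : R := (V1 x == enum_val t)%:R.

Lemma view_test_fun t : test_fun (view_test t).
Proof.
apply: (@test_fun_label _ _ _ _ V1 (fun s => (s == enum_val t)%:R)).
  exact: measurable_view.
by move=> s; case: (s == _) => /=; rewrite ?lexx ?lerN10 ?ler01 ?andbT// lerNl; lra.
Qed.

Variables (v2 : 'I_#|V| -> gX G2 -> R) (e : R).
Hypothesis t2 : forall t, test_fun (v2 t).
Hypotheses (e0 : 0 < e) (e_small : D.+1%:R * (2 * e) < 1 / 2).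
Hypothesis lv : levy_le view_test v2 e.

(** Two enlargements by [e] intervene: one makes the set of profiles of [G1] open, the other is that
    of the Levy-Prokhorov condition. By [e_small], an error of [2 * e] permits rounding at 1/2 and
    keeps the error in neighbour counts below 1. *)
Let near x y := linf (profile_map view_test x) (profile_map v2 y) < 2 * e.

Let e2_small : 2 * e < 1 / 2.
Proof.
apply: le_lt_trans e_small; rewrite ler_peMl ?ler1n//.
by rewrite mulr_ge0// ltW.
Qed.

Let nearP x y : near x y -> forall t, `|view_test t x - v2 t y| < 2 * e /\
  `|Pop (gE G1) (view_test t) x - Pop (gE G2) (v2 t) y| < 2 * e.
Proof.
have e20 : 0 < 2 * e by rewrite mulr_gt0.
move=> /(linf_ltP _ _ e20) H t.
have := H (unsplit (inl t)); have := H (unsplit (inr t)).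
by rewrite /profile_map !unsplitK.
Qed.

Let t0 : V := V1 point.

(** At a point near some x exactly one value exceeds 1/2; elsewhere [pick] and [t0] make an
    arbitrary choice. *)
Let F2 (y : gX G2) : V :=
  if [pick t | 1 / 2 < v2 t y] is Some t then enum_val t else t0.

Let mF2 : measurable_labeling F2.
Proof.
pose b y := [ffun t => 1 / 2 < v2 t y].
have mb : measurable_labeling b.
  apply: measurable_labeling_ffun => t.
  have mt : measurable ([set y | 1 / 2 < v2 t y] : set (borel (gX G2))).
    have -> : [set y | 1 / 2 < v2 t y] = setT `&` v2 t @^-1` `]1 / 2, +oo[.
      by rewrite setTI; apply/seteqP; split => x /=; rewrite in_itv/= andbT.
    by apply: (t2 t).1 => //; exact: measurable_itv.
  case; first by rewrite (_ : _ @^-1` _ = [set y | 1 / 2 < v2 t y]).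
  rewrite (_ : _ @^-1` _ = ~` [set y | 1 / 2 < v2 t y]); first exact: measurableC.
  by apply/seteqP; split => x /= => [->|/negP/negbTE].
have -> : F2 = (fun b : {ffun 'I_#|V| -> bool} =>
    if [pick t | b t] is Some t then enum_val t else t0) \o b.
  apply/funext => y; rewrite /F2 /=.
  by under [in RHS]eq_pick do rewrite ffunE.
exact: measurable_labeling_comp.
Qed.

Let near_F2 x y : near x y -> F2 y = V1 x /\
  forall t, `|v2 t y - (F2 y == enum_val t)%:R| <= 2 * e.
Proof.
move=> nxy; suff FV : F2 y = V1 x.
  by split => // t; rewrite FV distrC; exact/ltW/(nearP nxy t).1.
have key t : (1 / 2 < v2 t y) = (V1 x == enum_val t).
  have := (nearP nxy t).1; rewrite /view_test ltr_norml.
  have h := e2_small; case: (_ == _) => /= /andP[h1 h2]; last by apply/negbTE; rewrite -leNgt; lra.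
  by have -> : 1 / 2 < v2 t y by lra.
rewrite /F2; case: pickP => [t|H]; first by rewrite key => /eqP.
by have := H (enum_rank (V1 x)); rewrite key enum_rankK eqxx.
Qed.

(** The numbers n and m of neighbours labelled t differ by at most [D%:R * (2 * e)], from rounding
    [v2] at the neighbours, plus [2 * e] from the profiles. Being integers, they are equal. *)
Let near_star x y : near x y ->
  (forall z, gE G2 (y, z) -> exists x', near x' z) ->
  forall t, (exists2 z, gE G2 (y, z) & F2 z = t) <-> (exists2 z, gE G1 (x, z) & V1 z = t).
Proof.
move=> nxy Hz t; pose i := enum_rank t.
have [n [nE nP]] := Pop_indicator (fun z => V1 z == t) x.
have [m [mE mP]] := Pop_indicator (fun z => F2 z == t) y.
have e20 : 0 <= 2 * e by rewrite mulr_ge0// ltW.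
have d1 : `|Pop (gE G2) (v2 i) y - m%:R| <= D%:R * (2 * e).
  rewrite -mE; apply: Pop_dist => // z /Hz[x' nx'z].
  by have := (near_F2 nx'z).2 i; rewrite enum_rankK.
have d2 : `|n%:R - Pop (gE G2) (v2 i) y| < 2 * e.
  have := (nearP nxy i).2; rewrite -nE /view_test.
  by rewrite (_ : (fun x0 => _) = (fun z => (V1 z == t)%:R))// enum_rankK.
have nm : `|n%:R - m%:R| < 1 :> R.
  have := e_small; rewrite -natr1 mulrDl mul1r => H.
  by move: d1 d2; rewrite ler_norml !ltr_norml; move: (D%:R * (2 * e)) H => q; lra.
have nm' : n = m by exact: natr_dist_lt1 nm.
split => [[z yz Fz]|[z xz Vz]].
  have /nP[z' xz' /eqP ?] : (0 < n)%N by rewrite nm'; apply/mP; exists z => //; exact/eqP.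
  by exists z'.
have /mP[z' yz' /eqP ?] : (0 < m)%N by rewrite -nm'; apply/nP; exists z => //; exact/eqP.
by exists z'.
Qed.

Let c2 : gX G2 -> C := @rootColor C L \o F2.

Let V2 : gX G2 -> V := view (gE G2) c2 L.

(** The values of [F2] merely claim to be views; inductively they are the views of their own root
    colours. The points x' near the various z need not be adjacent to x: only their labels matter,
    and [near_star] finds a neighbour of x with the same label. *)
Let near_view l x y : (l <= L)%N -> near x y ->
  (forall z, within (gE G2) l y z -> exists x', near x' z) ->
  view (gE G2) c2 l y = view (gE G1) c1 l x.
Proof.
elim: l x y => [|l IH] x y lL nxy Hz.
  by rewrite /= /c2 /= (near_F2 nxy).1 rootColor_view.
have Hz1 z : gE G2 (y, z) -> forall w, within (gE G2) l z w -> exists x', near x' w.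
  by move=> yz w zw; apply: Hz; right; exists z.
have Hn z : gE G2 (y, z) -> exists x', near x' z.
  by move=> yz; apply: (Hz1 z yz); exact: within_refl.
have star := near_star nxy Hn.
have VW x1 x2 : V1 x1 = V1 x2 -> view (gE G1) c1 l x1 = view (gE G1) c1 l x2.
  by apply: viewW; exact: ltnW.
rewrite /=; congr (_, _).
  apply: IH => //; first exact: ltnW.
  by move=> z yz; apply: Hz; exact: withinW (leqnSn l) yz.
apply/setP => s; rewrite !finset.inE; apply/asboolP/asboolP => -[z [Ez <-]].
  have [x' nx'z] := Hn z Ez.
  have [z' xz' Vz'] := (star (F2 z)).1 (ex_intro2 _ _ z Ez erefl).
  exists z'; split => //; rewrite (IH x' z)//; last 2 first.
  - exact: ltnW.
  - exact: Hz1.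
  by apply: VW; rewrite Vz' (near_F2 nx'z).1.
have [z' yz' Fz'] := (star (V1 z)).2 (ex_intro2 _ _ z Ez erefl).
have [x' nx'z'] := Hn z' yz'.
exists z'; split => //; rewrite (IH x' z')//; last 2 first.
- exact: ltnW.
- exact: Hz1.
by apply: VW; rewrite -Fz' (near_F2 nx'z').1.
Qed.

Lemma view_transfer : exists2 c : gX G2 -> C, measurable_labeling c &
  forall P : set V, pr (view (gE G1) c1 L @^-1` P) <=
    pr (view (gE G2) c L @^-1` P) + (D.+1%:R ^+ L + 1) * e.
Proof.
have mc2 : measurable_labeling c2 by exact: measurable_labeling_comp.
have mV2 : measurable_labeling V2 by exact: measurable_view.
have mV1 : measurable_labeling V1 by exact: measurable_view.
exists c2 => // P.
pose U (Q : set V) := [set w | exists x, Q (V1 x) /\ linf (profile_map view_test x) w < e].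
pose Y Q : set (borel (gX G2)) := profile_map v2 @^-1` enlarge (U Q) e.
have oU Q : open_linf (U Q).
  move=> w [x [Qx xw]]; exists (e - linf (profile_map view_test x) w).
  rewrite subr_gt0; split => // w' ww'; exists x; split => //.
  apply: le_lt_trans (linf_triangle _ w _) _; by rewrite -ltrBrDl.
have mY Q : measurable (Y Q).
  by apply: measurable_profile => //; apply: open_borel_linf; exact: open_enlarge.
have Ynear Q y : Y Q y -> exists x, Q (V1 x) /\ near x y.
  move=> [w [[x [Qx xw]] wy]]; exists x; split => //.
  apply: le_lt_trans (linf_triangle _ w _) _.
  by rewrite mulr_natl mulr2n ltrD.
have prY Q : pr (V1 @^-1` Q) <= pr (Y Q) + e.
  apply: le_trans (lv (open_borel_linf (@oU Q))).1.
  apply: le_pr => //; first exact: measurable_label.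
    apply: measurable_profile; first exact: view_test_fun.
    exact: open_borel_linf (@oU Q).
  by move=> x Qx; exists x; rewrite linf_xx.
(* [prY] for the set of all labels shows that the points near nothing have probability at most [e];
   [N] consists of the points whose [L]-ball meets them. *)
pose B : set (borel (gX G2)) := ~` Y setT.
have mB : measurable B by exact: measurableC.
have prB : pr B <= e.
  rewrite prC//; have := prY setT; rewrite preimage_setT prT; lra.
pose N := [set y | exists z, within (gE G2) L y z /\ B z].
have mN : measurable (N : set (borel (gX G2))) by exact: measurable_within.
have prN : pr N <= D.+1%:R ^+ L * e.
  by apply: le_trans (pr_within L mB) _; rewrite ler_wpM2l// exprn_ge0.
apply: (le_trans (prY P)).
have : pr (Y P) <= pr (V2 @^-1` P `|` N).
  apply: le_pr => //; first by apply: measurableU => //; exact: measurable_label.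
  move=> y /Ynear[x [Px nxy]]; case: (pselect (N y)) => Ny; [by right|left].
  rewrite /= /V2 (near_view (leqnn L) nxy)// => z yz.
  have [|x' [_ ?]] := @Ynear setT z; last by exists x'.
  by apply: contrapT => nY; apply: Ny; exists z.
have mVP : measurable (V2 @^-1` P : set (borel (gX G2))) by exact: measurable_label.
have := prU_le mVP mN; rewrite mulrDl mul1r -/V2; lra.
Qed.

End Transfer.

(** * Ball sizes and the number of visible colours *)

Section BallSize.
Variables (R : realType) (D : nat).
Implicit Types G : graphing R D.

Definition ball_size_ge G (L n : nat) : set (gX G) :=
  [set x | exists s : seq (gX G), [/\ uniq s, (n <= size s)%N &
    forall z, z \in s -> within (gE G) L x z]].

Arguments ball_size_ge : clear implicits.

Lemma ball_size_le G L n x : ball_size_ge G L n x -> (n <= D.+1 ^ L)%N.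
Proof.
move=> [s [us ns Hs]]; have [t [tD Ht]] := within_finite (@gE_deg _ _ G) L x.
apply: leq_trans ns (leq_trans _ tD); apply: uniq_leq_size => // z /Hs.
by move/Ht.
Qed.

Lemma visible_ball_size G (C : finType) (c : gX G -> C) L n x :
  (n <= #|visible (view (gE G) c L x)|)%N -> ball_size_ge G L n x.
Proof.
move=> nv; have /choice[z Hz] a : exists z, a \in visible (view (gE G) c L x) ->
    within (gE G) L x z /\ c z = a.
  case: (boolP (a \in _)) => [/mem_visible[z xz cz]|_]; first by exists z.
  by exists x.
exists [seq z a | a <- enum (visible (view (gE G) c L x))]; split.
- rewrite map_inj_in_uniq ?enum_uniq// => a b; rewrite !mem_enum => /Hz[_ za] /Hz[_ zb] zab.
  by rewrite -za zab.
- by rewrite size_map -cardE.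
- by move=> _ /mapP[a + ->]; rewrite mem_enum => /Hz[].
Qed.

Lemma ball_size_visible G (C : finType) (c : gX G -> C) L n x :
  inj_ball (gE G) c L x -> ball_size_ge G L n x ->
  (n <= #|visible (view (gE G) c L x)|)%N.
Proof.
move=> inj [s [us ns Hs]]; apply: (leq_trans ns).
rewrite cardE -(size_map c); apply: uniq_leq_size.
  by rewrite map_inj_in_uniq// => y z /Hs xy /Hs xz; exact: inj.
move=> _ /mapP[z /Hs xz ->]; rewrite mem_enum.
by apply/mem_visible; exists z.
Qed.

(** If as many colours are visible as the ball has points, no colour can repeat in it. *)
Lemma inj_ball_visible G (C : finType) (c : gX G -> C) L x :
  (forall n, ball_size_ge G L n x -> (n <= #|visible (view (gE G) c L x)|)%N) ->
  inj_ball (gE G) c L x.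
Proof.
move=> H; have [t [_ Ht]] := within_finite (@gE_deg _ _ G) L x.
have : (size (undup t) <= #|visible (view (gE G) c L x)|)%N.
  apply: H; exists (undup t); split => //; first exact: undup_uniq.
  by move=> z; rewrite mem_undup => /Ht.
have : (#|visible (view (gE G) c L x)| <= size (undup (map c (undup t))))%N.
  rewrite cardE; apply: uniq_leq_size; first exact: enum_uniq.
  move=> a; rewrite mem_enum mem_undup => /mem_visible[z /Ht zt <-].
  by apply: map_f; rewrite mem_undup.
move=> h1 h2; have := leq_trans h2 h1; rewrite -(size_map c (undup t)).
rewrite leqNgt ltn_size_undup negbK => uc y z /Ht yt /Ht zt cyz.
have [iy iz] : (index y (undup t) < size (undup t))%N /\ (index z (undup t) < size (undup t))%N.
  by rewrite !index_mem !mem_undup.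
have := nth_uniq (c y) _ _ uc; rewrite size_map => /(_ _ _ iy iz).
rewrite !(nth_map y)// !nth_index ?mem_undup// cyz eqxx => /esym/eqP/(congr1 (nth y (undup t))).
by rewrite !nth_index// mem_undup.
Qed.

Lemma distance_coloring_inj G L : exists c : gX G -> 'I_(D.+1 ^ (L + L)).+1,
  measurable_labeling c /\ forall x, inj_ball (gE G) c L x.
Proof.
have [c [mc Hc]] := distance_coloring G (L + L).
by exists c; split => //; exact: inj_ball_coloring.
Qed.

Lemma measurable_ball_size G L n : measurable (ball_size_ge G L n : set (borel (gX G))).
Proof.
have [c [mc Hc]] := distance_coloring_inj G L.
rewrite (_ : ball_size_ge G L n = view (gE G) c L @^-1` [set t | (n <= #|visible t|)%N]).
  exact: measurable_label (measurable_view mc).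
apply/seteqP; split => [x /(ball_size_visible (Hc x))//|x].
exact: visible_ball_size.
Qed.

Lemma pr_bigcup_le G m (F : nat -> set (borel (gX G))) b :
  (forall n, measurable (F n)) -> (forall n, pr (F n) <= b) ->
  pr (\bigcup_(n in `I_m) F n) <= m%:R * b.
Proof.
move=> mF Fb; elim: m => [|m IH].
  by rewrite II0 bigcup_set0 mul0r /pr measure0.
have -> : \bigcup_(n in `I_m.+1) F n = (\bigcup_(n in `I_m) F n) `|` F m.
  by rewrite IIS bigcup_setU bigcup_set1.
have mB : measurable (\bigcup_(n in `I_m) F n) by exact: bigcup_measurable.
apply: (le_trans (prU_le mB (mF m))).
by rewrite -natr1 mulrDl mul1r lerD.
Qed.

Lemma prD G (A B : set (borel (gX G))) : measurable A -> measurable B -> B `<=` A ->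
  pr (A `\` B) = pr A - pr B.
Proof.
move=> mA mB BA; have mD := measurableD mA mB.
have e : pr A = pr B + pr (A `\` B).
  apply/EFin_inj; rewrite EFinD -!prE// -measureU//; last by rewrite setDIK.
  by rewrite setDUK.
lra.
Qed.

End BallSize.

Arguments ball_size_ge {R D}.

(** * From close profiles to close neighbourhood statistics *)

Section ActionToLocal.
Variables (R : realType) (D : nat).
Implicit Types G : graphing R D.

Definition levy_close M (e0 : R) G1 G2 :=
  forall v1 : 'I_M -> gX G1 -> R, (forall t, test_fun (v1 t)) ->
  exists v2 : 'I_M -> gX G2 -> R, (forall t, test_fun (v2 t)) /\
  exists2 e, 0 < e < e0 & levy_le v1 v2 e.

Lemma levy_close_transfer G1 G2 (C : finType) (c1 : gX G1 -> C) L e0 :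
  measurable_labeling c1 -> D.+1%:R * (2 * e0) < 1 / 2 ->
  levy_close #|viewType C L| e0 G1 G2 ->
  exists2 c2 : gX G2 -> C, measurable_labeling c2 &
  forall P : set (viewType C L), pr (view (gE G1) c1 L @^-1` P) <=
    pr (view (gE G2) c2 L @^-1` P) + (D.+1%:R ^+ L + 1) * e0.
Proof.
move=> mc1 small cl.
have [v2 [t2 [e /andP[e_gt0 ee0] lv]]] := cl _ (view_test_fun (L := L) mc1).
have small' : D.+1%:R * (2 * e) < 1 / 2.
  by apply: le_lt_trans small; rewrite ler_wpM2l// ler_wpM2l// ltW.
have [c2 mc2 H] := view_transfer mc1 t2 e_gt0 small' lv.
exists c2 => // P; apply: (le_trans (H P)); by rewrite lerD2l ler_wpM2l ?ltW.
Qed.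

(** On [G1] every point of a ball shows its own colour. The transferred colouring shows nearly as
    often at least n colours, and a ball of [G2] has at least as many points as visible colours. *)
Lemma ball_size_transfer G1 G2 (C : finType) (c1 : gX G1 -> C) L e0 n :
  measurable_labeling c1 -> (forall x, inj_ball (gE G1) c1 L x) ->
  D.+1%:R * (2 * e0) < 1 / 2 -> levy_close #|viewType C L| e0 G1 G2 ->
  pr (ball_size_ge G1 L n) <= pr (ball_size_ge G2 L n) + (D.+1%:R ^+ L + 1) * e0.
Proof.
move=> mc1 inj1 small /(levy_close_transfer mc1 small)[c2 mc2 H].
have := H [set t | (n <= #|visible t|)%N]; set A := _ @^-1` _; set B := _ @^-1` _ => AB.
apply: (@le_trans _ _ (pr A)).
  apply: le_pr; [exact: measurable_ball_size| |].
    exact: measurable_label (measurable_view mc1).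
  by move=> x; exact: ball_size_visible.
apply: (le_trans AB); rewrite lerD2r; apply: le_pr.
- exact: measurable_label (measurable_view mc2).
- exact: measurable_ball_size.
- by move=> x; exact: visible_ball_size.
Qed.

(* The transferred labelling only exhibits G2 as a local covering of G1; since
   ball sizes have nearly the same law in both graphings, the covering is
   injective on balls away from a set of small measure. *)
Lemma tv_transfer G1 G2 k r e0 (f1 : gX G1 -> 'I_k) (L := r.+1)
    (C : finType := ('I_(D.+1 ^ (L + L)).+1 * 'I_k)%type) :
  coloring f1 -> (exists f : gX G2 -> 'I_k, coloring f) -> 0 <= e0 ->
  D.+1%:R * (2 * e0) < 1 / 2 ->
  levy_close #|viewType C L| e0 G1 G2 -> levy_close #|viewType C L| e0 G2 G1 ->
  exists f2 : gX G2 -> 'I_k, coloring f2 /\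
    tv_tau r f1 f2 <= ((2 * (D.+1 ^ L).+1).+1)%:R * ((D.+1%:R ^+ L + 1) * e0).
Proof.
move=> cf1 [g2 cg2] e0_ge0 small cl12 cl21; set b := _ * e0.
have b0 : 0 <= b by rewrite mulr_ge0// addr_ge0// exprn_ge0.
(* [G2] receives an injective colouring too, for the transfer of ball sizes back to [G1]; pairing it
   with the arbitrary [g2] keeps the colour type [C], hence the number of test functions. *)
have labeling G (f : gX G -> 'I_k) : coloring f ->
    exists2 d : gX G -> 'I_(D.+1 ^ (L + L)).+1,
      measurable_labeling (fun x => (d x, f x) : C) &
      forall x, inj_ball (gE G) (fun x => (d x, f x) : C) L x.
  move=> cf; have [d [md Hd]] := distance_coloring_inj G L.
  exists d; first exact: measurable_labeling_pair.
  by move=> x y z xy xz [dyz _]; exact: (Hd x).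
have [d1 mc1 inj1] := labeling _ _ cf1; have [d2 md2 injd2] := labeling _ _ cg2.
set c1 := (fun x => _) in mc1 inj1.
have [c2 mc2 H] := levy_close_transfer mc1 small cl12.
pose V1 := view (gE G1) c1 L; pose V2 := view (gE G2) c2 L.
have mV1 : measurable_labeling V1 by exact: measurable_view.
have mV2 : measurable_labeling V2 by exact: measurable_view.
pose f2 : gX G2 -> 'I_k := snd \o c2.
have cf2 : coloring f2 by exact: measurable_labeling_comp mc2.
exists f2; split => //.
pose big2 n : set (borel (gX G2)) := ball_size_ge G2 L n.
pose vis n : set (viewType C L) := [set t | (n <= #|visible t|)%N].
have mbig n : measurable (big2 n) by exact: measurable_ball_size.
have mvis n : measurable (V2 @^-1` vis n : set (borel (gX G2))) by exact: measurable_label.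
pose Bad := \bigcup_(n in `I_(D.+1 ^ L).+1) (big2 n `\` V2 @^-1` vis n).
have mBad : measurable (Bad : set (borel (gX G2))).
  by apply: bigcup_measurable => n _; exact: measurableD.
(* For each n, one [b] is paid for transferring ball sizes from [G2] to [G1] and one for
   transferring views back to [G2]. *)
have prBad : pr Bad <= (D.+1 ^ L).+1%:R * (2 * b).
  apply: pr_bigcup_le => n; first exact: measurableD.
  rewrite prD//; last by move=> y; exact: visible_ball_size.
  have h1 := ball_size_transfer n md2 injd2 small cl21.
  have h2 : pr (ball_size_ge G1 L n) <= pr (V1 @^-1` vis n).
    apply: le_pr; [exact: measurable_ball_size|exact: measurable_label|].
    by move=> x; exact: ball_size_visible.
  have := H (vis n); rewrite -/V1 -/V2 /big2 -/b in h1 *; lra.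
have inj2 y : ~ Bad y -> inj_ball (gE G2) c2 L y.
  move=> nB; apply: inj_ball_visible => n ny; apply: contrapT => nv; apply: nB.
  by exists n => //=; rewrite ltnS; exact: ball_size_le ny.
have iso12 x y Hg : ~ Bad y -> V1 x = V2 y ->
    ball_iso (gE G1) f1 r x Hg <-> ball_iso (gE G2) f2 r y Hg.
  move=> /inj2 iy xy; have -> : f1 = snd \o c1 by [].
  by split; [exact: ball_iso_view xy|exact: ball_iso_view (esym xy)].
apply: tv_tau_le => Q.
pose A1 : set (borel (gX G1)) := [set x | exists H, Q H /\ ball_iso (gE G1) f1 r x H].
pose A2 : set (borel (gX G2)) := [set x | exists H, Q H /\ ball_iso (gE G2) f2 r x H].
have mA1 : measurable A1 by exact: measurable_ball_iso.
have mA2 : measurable A2 by exact: measurable_ball_iso.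
(* The transfer is one-sided; applying this to [A1], [A2] and to their complements gives both
   bounds. The last [b] is the error in the law of the views. *)
have step (S1 : set (borel (gX G1))) (S2 : set (borel (gX G2))) :
    measurable S1 -> measurable S2 ->
    (forall x y, ~ Bad y -> V1 x = V2 y -> S1 x -> S2 y) ->
    pr S1 <= pr S2 + (D.+1 ^ L).+1%:R * (2 * b) + b.
  move=> m1 m2 S12; pose P := V1 @` S1.
  have h1 : pr S1 <= pr (V1 @^-1` P).
    by apply: le_pr => //; [exact: measurable_label|move=> x Sx; exists x].
  have h2 := H P.
  have h3 : pr (V2 @^-1` P) <= pr (S2 `|` Bad).
    apply: le_pr; [exact: measurable_label|exact: measurableU|].
    move=> y [x Sx xy]; case: (pselect (Bad y)) => By; [by right|left].
    exact: S12 Sx.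
  have h4 := prU_le m2 mBad.
  rewrite -/V1 -/V2 -/b in h2; move: h1 h2 h3 h4 prBad; lra.
have s1 := step A1 A2 mA1 mA2 _.
have s2 := step (~` A1) (~` A2) (measurableC mA1) (measurableC mA2) _.
have tauE1 : tau r f1 Q = pr A1 by [].
have tauE2 : tau r f2 Q = pr A2 by [].
rewrite tauE1 tauE2 ler_norml.
have {}s1 : pr A1 <= pr A2 + (D.+1 ^ L).+1%:R * (2 * b) + b.
  by apply: s1 => x y nB xy [Hg [QH /(iso12 _ _ _ nB xy) yH]]; exists Hg.
have {}s2 : pr (~` A1) <= pr (~` A2) + (D.+1 ^ L).+1%:R * (2 * b) + b.
  apply: s2 => x y nB xy nA [Hg [QH /(iso12 _ _ _ nB xy) xH]]; apply: nA.
  by exists Hg.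
rewrite !prC// in s2.
have -> : ((2 * (D.+1 ^ L).+1).+1)%:R * b = (D.+1 ^ L).+1%:R * (2 * b) + b.
  by rewrite -natr1 natrM mulrDl mul1r mulrA [2 * _]mulrC.
move: s1 s2; move: ((D.+1 ^ L).+1%:R * (2 * b)) => q; lra.
Qed.

Lemma action_local_global (Gs : nat -> graphing R D) :
  action_convergent Gs -> local_global_convergent Gs.
Proof.
move=> ac k r k0 r0 eps eps0.
pose L := r.+1; pose C : finType := ('I_(D.+1 ^ (L + L)).+1 * 'I_k)%type.
have M0 : (0 < #|viewType C L|)%N.
  apply/card_gt0P; exists (view (gE (Gs 0%N)) (fun=> (ord0, Ordinal k0) : C) L point).
  by [].
pose K : R := ((2 * (D.+1 ^ L).+1).+1)%:R * (D.+1%:R ^+ L + 1).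
have K0 : 0 < K by rewrite mulr_gt0// addr_gt0// exprn_gt0.
(* The first term makes the final error at most [eps / 2]; the second gives [D.+1%:R * (2 * e0)] at
   most 1/4, below the rounding threshold. *)
pose e0 := Num.min (eps / 2 / K) (1 / (8 * D.+1%:R)).
have e0_gt0 : 0 < e0.
  by rewrite lt_min !divr_gt0//= mulr_gt0.
have e0K : K * e0 <= eps / 2.
  by rewrite mulrC -ler_pdivlMr// ge_min lexx.
have small : D.+1%:R * (2 * e0) < 1 / 2.
  have h : e0 <= 1 / (8 * D.+1%:R) by rewrite ge_min lexx orbT.
  apply: (@le_lt_trans _ _ (1 / 4)); last by lra.
  move: h; rewrite ler_pdivlMr ?mulr_gt0//; move: (D.+1%:R : R) => q; lra.
have [N HN] := ac _ M0 _ e0_gt0.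
exists N => i j Ni Nj; apply: (@le_lt_trans _ _ (eps / 2)); last by lra.
have [H1 H2] := dH_S_lt (HN i j Ni Nj).
have cl12 : levy_close #|viewType C L| e0 (Gs i) (Gs j).
  move=> v1 t1; have [v2 [t2 /(levy_prokhorov_lt t1 t2)[e ee0 lv]]] := H1 v1 t1.
  by exists v2; split => //; exists e.
have cl21 : levy_close #|viewType C L| e0 (Gs j) (Gs i).
  move=> v2 t2; have [v1 [t1 /(levy_prokhorov_lt t1 t2)[e ee0 lv]]] := H2 v2 t2.
  by exists v1; split => //; exists e => //; exact: levy_le_sym.
apply: dH_Z_le => // [f1 c1|f2 c2].
  have [f2 [c2 tv]] := tv_transfer c1 (coloring_exists (Gs j) k0) (ltW e0_gt0) small cl12 cl21.
  by exists f2; split => //; apply: (le_trans tv); rewrite mulrA.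
have [f1 [c1 tv]] := tv_transfer c2 (coloring_exists (Gs i) k0) (ltW e0_gt0) small cl21 cl12.
by exists f1; split => //; rewrite tv_tau_sym; apply: (le_trans tv); rewrite mulrA.
Qed.

End ActionToLocal.

Theorem theorem9p4 (R : realType) (D : nat) (Gs : nat -> graphing R D) :
  local_global_convergent Gs <-> action_convergent Gs.
Proof. by split; [exact: local_global_action|exact: action_local_global]. Qed.
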